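(* Let $k,n\ge1$, $m=kn-1$, and let $g$ be the metric on $\mathbb P_m\mathbb C$ described in the context with $a_m=m+1$, $dv$ its volume element. For every $\alpha<1$ there exists a constant $C$ such that $$\int_{\mathbb P_m\mathbb C}e^{-\alpha\varphi}\,dv\le C$$ for every $\varphi\in C^\infty(\mathbb P_m\mathbb C)$ that is $g$-admissible, $G_{n,k}$-invariant, and satisfies $\sup_{\mathbb P_m\mathbb C}\varphi=0$.
   Context: Homogeneous coordinates on $\mathbb P_m\mathbb C$, $m=kn-1$, are written $[z_0,\dots,z_m]=[Z_0,\dots,Z_{k-1}]$ with blocks $Z_h=(z_{hn},\dots,z_{(h+1)n-1})\in\mathbb C^n$. The metric $g$ is $a_m$ times the Fubini–Study metric: in the chart $\{z_0=1\}$ its components are $g_{\lambda\bar\mu}=a_m\,\partial^2\ln(1+|z_1|^2+\cdots+|z_m|^2)/\partial z_\lambda\partial\bar z_\mu$. A function $\varphi\in C^\infty(\mathbb P_m\mathbb C)$ is $g$-admissible if $g_{\lambda\bar\mu}+\partial^2\varphi/\partial z_\lambda\partial\bar z_\mu$ is positive definite everywhere. $G_{n,k}$ is the group of automorphisms of $\mathbb P_m\mathbb C$ generated by: swaps of two blocks $Z_i,Z_j$; multiplication of a single homogeneous coordinate $z_p$ by $e^{i\theta}$; and transpositions of two coordinates $z_p,z_q$ lying in the same block $Z_h$. *)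

(* Defs.v *)
From HB Require Import structures.
From mathcomp Require Import all_boot all_order all_algebra.
From mathcomp Require Import all_classical all_reals all_analysis.
From mathcomp.real_closed Require Import complex.
Set Implicit Arguments. Unset Strict Implicit. Unset Printing Implicit Defensive.
Import Order.TTheory GRing.Theory Num.Theory.
Import numFieldNormedType.Exports.
Local Open Scope ring_scope.
Local Open Scope classical_set_scope.

(* Encoding.  A point of C^N is a real matrix Z : 'M[R]_(2, N); the complex  *)
(* coordinate z_c is  Z 0 c + i Z 1 c  (row 0 = real parts, row 1 = imag.).  *)
(* A function phi on P_{N-1}C is represented by Phi : 'M_(2,N) -> R, i.e.    *)
(* phi o pi on C^N \ {0}, which must be invariant under C^* scaling.         *)

Definition re_ix : 'I_2 := ord0.
Definition im_ix : 'I_2 := @Ordinal 2 1 isT.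

Fixpoint diter {R : realType} {p q : nat} (f : 'M[R]_(p, q) -> R)
    (vs : seq 'M[R]_(p, q)) : 'M[R]_(p, q) -> R :=
  match vs with
  | [::] => f
  | v :: vs' => fun x => 'D_v (diter f vs') x
  end.

Definition smooth_on {R : realType} {p q : nat} (D : set 'M[R]_(p, q))
    (f : 'M[R]_(p, q) -> R) : Prop :=
  forall vs : seq 'M[R]_(p, q),
    (forall (v x : 'M[R]_(p, q)), D x -> derivable (diter f vs) x v) /\
    (forall x, D x -> {for x, continuous (diter f vs)}).

Definition cscale {R : realType} {N : nat} (a b : R) (Z : 'M[R]_(2, N))
  : 'M[R]_(2, N) :=
  \matrix_(r, c) if r == re_ix then a * Z re_ix c - b * Z im_ix c
                 else a * Z im_ix c + b * Z re_ix c.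

Definition proj_invariant {R : realType} {N : nat} (Phi : 'M[R]_(2, N) -> R)
  : Prop :=
  forall (a b : R) (Z : 'M[R]_(2, N)), (a, b) != (0, 0) -> Z != 0 ->
    Phi (cscale a b Z) = Phi Z.

Definition chart {R : realType} {m : nat} (j : 'I_m.+1) (w : 'M[R]_(2, m))
  : 'M[R]_(2, m.+1) :=
  \matrix_(r, c) match unlift j c with
                 | Some c' => w r c'
                 | None => (r == re_ix)%:R
                 end.

Definition ex {R : realType} {m : nat} (l : 'I_m) : 'M[R]_(2, m) :=
  delta_mx re_ix l.
Definition ey {R : realType} {m : nat} (l : 'I_m) : 'M[R]_(2, m) :=
  delta_mx im_ix l.

(* complex Hessian  ( d^2 f / dz_l d zbar_mu )_{l,mu}  at w, with
   d/dz = (d/dx - i d/dy)/2 and d/dzbar = (d/dx + i d/dy)/2 *)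
Definition cplx_hessian {R : realType} {m : nat} (f : 'M[R]_(2, m) -> R)
    (w : 'M[R]_(2, m)) : 'M[R[i]]_m :=
  \matrix_(l, mu)
    Complex (('D_(ex l) ('D_(ex mu) f) w + 'D_(ey l) ('D_(ey mu) f) w) / 4)
            (('D_(ex l) ('D_(ey mu) f) w - 'D_(ey l) ('D_(ex mu) f) w) / 4).

Definition pos_def_herm {R : realType} {m : nat} (H : 'M[R[i]]_m) : Prop :=
  forall xi : 'rV[R[i]]_m, xi != 0 ->
    0 < \sum_(l < m) \sum_(mu < m) H l mu * xi 0 l * (xi 0 mu)^*.

Definition sqnorm {R : realType} {m : nat} (w : 'M[R]_(2, m)) : R :=
  \sum_(r < 2) \sum_(c < m) w r c ^+ 2.
Definition fs_potential {R : realType} {m : nat} (a : R) (w : 'M[R]_(2, m))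
  : R := a * ln (1 + sqnorm w).

(* g-admissible, with g = a * (Fubini-Study): in every affine chart
   {z_j = 1} and at every point, g_{l mu} + d^2 phi/dz_l dzbar_mu > 0. *)
Definition admissible {R : realType} {m : nat} (a : R)
    (Phi : 'M[R]_(2, m.+1) -> R) : Prop :=
  forall (j : 'I_m.+1) (w : 'M[R]_(2, m)),
    pos_def_herm
      (cplx_hessian (fun w' => fs_potential a w' + Phi (chart j w')) w).

Definition permZ {R : realType} {m : nat} (s : nat -> nat)
    (Z : 'M[R]_(2, m.+1)) : 'M[R]_(2, m.+1) :=
  \matrix_(r, c) Z r (inord (s c)).

Definition block_swap (n i j : nat) (p : nat) : nat :=
  if (p %/ n == i)%N then (j * n + p %% n)%N
  else if (p %/ n == j)%N then (i * n + p %% n)%N else p.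

Definition transp (p q : nat) (c : nat) : nat :=
  if c == p then q else if c == q then p else c.

Definition rotZ {R : realType} {m : nat} (p : nat) (theta : R)
    (Z : 'M[R]_(2, m.+1)) : 'M[R]_(2, m.+1) :=
  \matrix_(r, c)
    if (c : nat) == p then
      (if r == re_ix then cos theta * Z re_ix c - sin theta * Z im_ix c
       else sin theta * Z re_ix c + cos theta * Z im_ix c)
    else Z r c.

(* the (linear lifts of the) elements of G_{n,k}, acting on C^{kn}, where
   m.+1 = k n : closure of the generators under composition (this is the
   generated group: each generator has an inverse of the same kind). *)
Unset Implicit Arguments.
Inductive Gnk (R : realType) (k n m : nat)
  : ('M[R]_(2, m.+1) -> 'M[R]_(2, m.+1)) -> Prop :=
| Gnk_id : Gnk R k n m id
| Gnk_swap (i j : nat) : (i < k)%N -> (j < k)%N ->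
    Gnk R k n m (permZ (block_swap n i j))
| Gnk_rot (p : nat) (theta : R) : (p < m.+1)%N -> Gnk R k n m (rotZ p theta)
| Gnk_transp (p q : nat) : (p < m.+1)%N -> (q < m.+1)%N ->
    (p %/ n = q %/ n)%N -> Gnk R k n m (permZ (transp p q))
| Gnk_comp f g : Gnk R k n m f -> Gnk R k n m g -> Gnk R k n m (f \o g).
Set Implicit Arguments.

Definition Gnk_invariant {R : realType} (k n m : nat)
    (Phi : 'M[R]_(2, m.+1) -> R) : Prop :=
  forall sigma, Gnk R k n m sigma ->
    forall Z : 'M[R]_(2, m.+1), Z != 0 -> Phi (sigma Z) = Phi Z.

(* Lebesgue integral over R^d of a nonnegative function, as an iterated
   integral (equal to the product-measure integral by Tonelli). *)
Fixpoint iter_int {R : realType} (d : nat) (F : (nat -> R) -> \bar R)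
  : \bar R :=
  match d with
  | 0 => F (fun _ => 0)
  | d'.+1 => (\int[@lebesgue_measure R]_t
               iter_int d' (fun x => F (fun i => if i == d' then t else x i)))%E
  end.

Definition mx_of_coords {R : realType} {m : nat} (x : nat -> R)
  : 'M[R]_(2, m) := \matrix_(r, c) x (2 * c + r)%N.

(* volume element of g = a * FS in the chart {z_0 = 1} (whose complement has
   measure zero): det(g_{l mu}) times Lebesgue measure on C^m = R^{2m}. *)
Definition vol_density {R : realType} {m : nat} (a : R) (w : 'M[R]_(2, m))
  : R := complex.Re (\det (cplx_hessian (fs_potential a) w)).

Definition integral_exp {R : realType} {m : nat} (a alpha : R)
    (Phi : 'M[R]_(2, m.+1) -> R) : \bar R :=
  iter_int (2 * m)%N (fun x =>
    let w : 'M[R]_(2, m) := mx_of_coords x in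
    (expR (- (alpha * Phi (chart ord0 w))) * vol_density a w)%:E).

(* Main.v *)
(* Write Psi = N ln |Z|^2 + Phi with N = m + 1 = k n. Admissibility says that Psi is
   plurisubharmonic, and Phi is invariant under the torus, so Psi is a convex function
   of the x_c = ln |z_c|, and it satisfies Psi(x + t (1,..,1)) = Psi(x) + 2 N t.
   G_{n,k} permutes the coordinates transitively, so the gradient of Psi at x = 0 is
   (2,..,2), and the tangent inequality reads Psi(x) >= Psi(0) + 2 sum_c x_c.
   Plurisubharmonicity also makes Psi nondecreasing in each |z_c|, hence
   Phi(Z) <= Phi(1,..,1) + N ln N, and sup Phi = 0 forces Phi(1,..,1) >= - N ln N.
   In the chart z_0 = 1 these two bounds give, for 0 <= alpha < 1,
     e^{- alpha Phi} dv <= N^m prod_c |z_c|^{- 2 alpha} (1 + |z|^2)^{- N (1 - alpha)},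
   and the right-hand side is dominated by a product of integrable functions of the
   2 m real coordinates. For alpha < 0 use Phi <= 0. *)

Require Import Defs.
From HB Require Import structures.
From mathcomp Require Import all_boot all_order all_algebra.
From mathcomp Require Import all_classical all_reals all_analysis.
From mathcomp.real_closed Require Import complex.
From mathcomp Require Import measurable_realfun ring lra zify.
Import Order.TTheory GRing.Theory Num.Theory.
Import numFieldNormedType.Exports.
Local Open Scope ring_scope.
Local Open Scope classical_set_scope.

Set Implicit Arguments.
Unset Strict Implicit.
Unset Printing Implicit Defensive.

(** * Differentiability from continuous directional derivatives *)

(** Along [v] the map [A] moves by multiples of [w], so both difference quotients are the same
    function of [h]. Lines, affine charts and permutations of coordinates are all differentiated
    this way. *)
Lemma derivable_affine (R : realType) (U V : normedModType R) (f : V -> R)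
    (A : U -> V) (x v : U) (w : V) :
  (forall h : R, A (h *: v + x) = h *: w + A x) ->
  (derivable (f \o A) x v <-> derivable f (A x) w) /\
  'D_v (f \o A) x = 'D_w f (A x).
Proof.
move=> hA; rewrite /derivable /derive.
suff -> : (fun h : R => h^-1 *: (((f \o A) \o shift x) (h *: v) - (f \o A) x)) =
  (fun h : R => h^-1 *: ((f \o shift (A x)) (h *: w) - f (A x))) by [].
by apply/funext => h /=; rewrite hA.
Qed.

Lemma line_is_derive (R : realType) (V : normedModType R) (f : V -> R)
    (y e : V) (t : R) : derivable f (y + t *: e) e ->
  is_derive t (1 : R) (fun s : R => f (y + s *: e)) ('D_e f (y + t *: e)).
Proof.
move=> df; have [|[_ /(_ df) d1] d2] := @derivable_affine R R V f (fun s : R => y + s *: e) t 1 e.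
  by move=> h /=; rewrite scalerDl addrCA /GRing.scale/= mulr1.
by split.
Qed.

Lemma MVT_line (R : realType) (V : normedModType R) (f : V -> R) (y e : V) (a : R) :
  (forall t : R, `|t| <= `|a| -> derivable f (y + t *: e) e) ->
  exists2 c : R, `|c| <= `|a| & f (y + a *: e) - f y = 'D_e f (y + c *: e) * a.
Proof.
move=> df; pose g := fun s : R => f (y + s *: e).
have dg t : `|t| <= `|a| -> is_derive t (1 : R) g ('D_e f (y + t *: e)).
  by move=> /df; exact: line_is_derive.
have cg (i : interval R) : (forall t, t \in i -> `|t| <= `|a|) ->
    {within [set` i], continuous g}.
  move=> hi; apply: derivable_within_continuous => t /hi /dg []//.
have g0 : g 0 = f y by rewrite /g scale0r addr0.
case: (leP 0 a) => a0.
- have hi t : t \in `[0, a]%R -> `|t| <= `|a|.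
    by rewrite in_itv/= => /andP[t0 ta]; rewrite !ger0_norm.
  have [|c ci E] := @MVT_segment R g (fun t => 'D_e f (y + t *: e)) 0 a a0 _ (cg _ hi).
    by move=> t ti; apply: dg; apply: hi; apply: subset_itv_oo_cc ti.
  by exists c; [exact: hi|rewrite -g0 -[a in RHS]subr0].
- have hi t : t \in `[a, 0]%R -> `|t| <= `|a|.
    by rewrite in_itv/= => /andP[t0 ta]; rewrite !ler0_norm ?lerN2// ltW.
  have [|c ci E] := @MVT_segment R g (fun t => 'D_e f (y + t *: e)) a 0 (ltW a0) _ (cg _ hi).
    by move=> t ti; apply: dg; apply: hi; apply: subset_itv_oo_cc ti.
  exists c; first exact: hi.
  by rewrite -g0 -opprB E sub0r mulrN opprK.
Qed.

Lemma mx_entry_norm_le (R : realType) p q (h : 'M[R]_(p, q)) i j : `|h i j| <= `|h|.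
Proof. by rewrite [leRHS]/Num.Def.normr/= mx_normrE; exact: (le_bigmax _ _ (i, j)). Qed.

Lemma delta_mx_norm_le (R : realType) p q (a : R) (i : 'I_p) (j : 'I_q) :
  `|a *: delta_mx i j : 'M[R]_(p, q)| <= `|a|.
Proof.
rewrite [leLHS]/Num.Def.normr/= mx_normrE; apply: bigmax_le => //= -[i' j'] _.
by rewrite !mxE; case: (_ && _); rewrite ?mulr1// mulr0 normr0.
Qed.

(** The estimate is the little-o expansion of [f] at [x], and uniqueness of the differential
    identifies [L] with it. *)
Lemma differentiable_linear_approx (R : realType) (V W : normedModType R)
    (f : V -> W) (L : {linear V -> W}) (x : V) : continuous L ->
  (forall e : R, 0 < e -> \forall h \near (0 : V),
     `|f (x + h) - f x - L h| <= e * `|h|) ->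
  differentiable f x.
Proof.
move=> Lc hL.
have E : f \o shift x = cst (f x) + L +o_ 0 id.
  apply/eqaddoP => e e0; have := hL _ e0.
  by apply: filterS => h /=; rewrite !fctE /= opprD addrA [h + x]addrC.
by apply/diff_locallyP; rewrite (diff_unique Lc E).
Qed.

Section C1.
Variables (R : realType) (p q : nat) (f : 'M[R]_(p, q) -> R) (x : 'M[R]_(p, q)).
Hypothesis df : \forall y \near x, forall v, derivable f y v.
Hypothesis cf : forall v, {for x, continuous ('D_v f)}.

(** Truncating a displacement to the coordinates listed in [s] lets the increment of [f] be
    telescoped along the axes; with all indices listed, [part s h] is [h]. *)
Let part (s : seq ('I_p * 'I_q)) (h : 'M[R]_(p, q)) :=
  \sum_(c <- s) h c.1 c.2 *: delta_mx c.1 c.2 : 'M[R]_(p, q).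
Let lpart (s : seq ('I_p * 'I_q)) (h : 'M[R]_(p, q)) :=
  \sum_(c <- s) h c.1 c.2 * 'D_(delta_mx c.1 c.2) f x.

Lemma part_norm_le s h : `|part s h| <= (size s)%:R * `|h|.
Proof.
elim: s => [|c s IH]; first by rewrite /part big_nil normr0 mul0r.
rewrite /part big_cons /= (le_trans (ler_normD _ _))// -natr1 mulrDl mul1r.
rewrite [leRHS]addrC lerD ?IH//.
exact: le_trans (delta_mx_norm_le _ _ _) (mx_entry_norm_le _ _ _).
Qed.

(** Each further coordinate is a move parallel to one axis: the mean value theorem turns it into a
    partial derivative at a nearby point, and continuity at [x] makes the error at most [e / 2]
    times [|h|]. The induction hypothesis takes the other half. *)
Lemma C1_telescope (s : seq ('I_p * 'I_q)) (e : R) : 0 < e ->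
  \forall h \near (0 : 'M[R]_(p, q)),
    `|f (x + part s h) - f x - lpart s h| <= e * `|h|.
Proof.
elim: s e => [|c s IH] e e0.
  by near=> h; rewrite /part /lpart !big_nil addr0 subrr subr0 normr0 mulr_ge0// ltW.
have e20 : 0 < e / 2 by rewrite divr_gt0.
have /nbhs_ballP[d /= d0 hd] : nbhs x [set y | (forall v, derivable f y v) /\
    `|'D_(delta_mx c.1 c.2) f x - 'D_(delta_mx c.1 c.2) f y| <= e / 2].
  apply: filterI; first exact: df.
  by have /cvgrPdist_le := @cf (delta_mx c.1 c.2); apply.
have hd' y : `|x - y| < d -> (forall v, derivable f y v) /\
    `|'D_(delta_mx c.1 c.2) f x - 'D_(delta_mx c.1 c.2) f y| <= e / 2.
  by move=> xy; apply: hd; rewrite -ball_normE.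
near=> h.
have hs : `|f (x + part s h) - f x - lpart s h| <= e / 2 * `|h|.
  by near: h; exact: IH.
(* The path has at most [(size s).+1] axis moves, each of length at most [|h|], so it stays within
   [d] of [x]. *)
have hn : `|h| < d / (size s).+1%:R.
  near: h; apply/nbhs_ballP; exists (d / (size s).+1%:R) => /=.
    by rewrite divr_gt0.
  by move=> h; rewrite -ball_normE /ball_ /= sub0r normrN.
have near_pt t : `|t| <= `|h c.1 c.2| ->
    `|x - (x + part s h + t *: delta_mx c.1 c.2)| < d.
  move=> ht; rewrite -addrA opprD addrA subrr sub0r normrN.
  rewrite (le_lt_trans (ler_normD _ _))//.
  rewrite (@le_lt_trans _ _ ((size s).+1%:R * `|h|))//.
    rewrite -natr1 mulrDl mul1r lerD ?part_norm_le//.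
    exact: le_trans (delta_mx_norm_le _ _ _) (le_trans ht (mx_entry_norm_le _ _ _)).
  by rewrite mulrC -ltr_pdivlMr.
have [t|t ta Et] := @MVT_line R _ f (x + part s h) (delta_mx c.1 c.2) (h c.1 c.2).
  by move=> /near_pt /hd'[+ _]; apply.
have [_ hD] := hd' _ (near_pt _ ta).
have -> : part (c :: s) h = part s h + h c.1 c.2 *: delta_mx c.1 c.2.
  by rewrite /part big_cons addrC.
rewrite addrA /lpart big_cons -/(lpart s h).
set D := 'D__ f x; set D' := 'D__ f _ in Et hD.
have -> : f (x + part s h + h c.1 c.2 *: delta_mx c.1 c.2) - f x -
    (h c.1 c.2 * D + lpart s h) =
    (f (x + part s h) - f x - lpart s h) - (D - D') * h c.1 c.2.
  by rewrite mulrBl -Et -/D; ring.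
apply: le_trans (ler_normB _ _) _; rewrite [e in leRHS]splitr [leRHS]mulrDl lerD// normrM.
by rewrite ler_pM// mx_entry_norm_le.
Unshelve. all: by end_near. Qed.

(** [smooth_on] only speaks of directional derivatives and their continuity; the chain rule along
    curves needs the full differential. *)
Lemma C1_differentiable : differentiable f x.
Proof.
pose L (h : 'M[R]_(p, q)) := lpart (index_enum ('I_p * 'I_q)%type) h.
have Llin : linear (L : _ -> R).
  move=> a u v; rewrite /L /lpart scaler_sumr -big_split/=.
  by apply: eq_bigr => c _; rewrite !mxE /GRing.scale/=; ring.
pose LM := GRing.isLinear.Build _ _ _ _ _ Llin.
pose LL : {linear 'M[R]_(p, q) -> R} := HB.pack (L : _ -> R) LM.
have Lc : continuous LL.
  rewrite /LL /= /L => h; elim: (index_enum _) => [|c s IH].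
    by rewrite /lpart; under eq_fun do rewrite big_nil; exact: cst_continuous.
  rewrite (_ : lpart (c :: s) =
      (fun h : 'M[R]_(p, q) => h c.1 c.2 * 'D_(delta_mx c.1 c.2) f x) \+ lpart s).
    apply: continuousD; last exact: IH.
    by apply: continuousM; [exact: coord_continuous|exact: cst_continuous].
  by apply/funext => k; rewrite /lpart big_cons.
apply: (differentiable_linear_approx Lc) => e e0.
have := C1_telescope (index_enum ('I_p * 'I_q)%type) e0.
apply: filterS => h.
suff -> : part (index_enum ('I_p * 'I_q)%type) h = h by [].
rewrite /part [RHS]matrix_sum_delta pair_big/=.
by apply: eq_bigr => -[i j].
Qed.

End C1.

Lemma diff_sum_delta (R : realType) p q (f : 'M[R]_(p, q) -> R) x v :
  differentiable f x ->
  'D_v f x = \sum_i \sum_j v i j * 'D_(delta_mx i j) f x.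
Proof.
move=> df; rewrite deriveE// [v in LHS]matrix_sum_delta linear_sum.
apply: eq_bigr => i _; rewrite linear_sum; apply: eq_bigr => j _.
by rewrite linearZ deriveE.
Qed.

Lemma curve_is_derive (R : realType) p q (f : 'M[R]_(p, q) -> R)
    (g : R -> 'M[R]_(p, q)) (t : R) (dg : 'M[R]_(p, q)) :
  differentiable f (g t) ->
  (forall i j, is_derive t (1 : R) (fun s => g s i j) (dg i j)) ->
  is_derive t (1 : R) (f \o g) ('D_dg f (g t)).
Proof.
move=> df hg.
have gd : derivable g t 1 by apply/derivable_mxP => i j; case: (hg i j).
have gE : 'D_1 g t = dg.
  by rewrite derive_mx//; apply/matrixP => i j; rewrite mxE; case: (hg i j).
have gdf : differentiable g t by apply/derivable1_diffP.
have cd := differentiable_comp gdf df.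
split; first exact/derivable1_diffP.
by rewrite deriveE// diff_comp//= -(deriveE _ gdf) gE deriveE.
Qed.

(** * Torus-invariant plurisubharmonic functions *)

Lemma is_derive_sumf (R : realType) n (h : 'I_n -> R -> R) (dh : 'I_n -> R) (t : R) :
  (forall i, is_derive t (1 : R) (h i) (dh i)) ->
  is_derive t (1 : R) (fun s => \sum_i h i s) (\sum_i dh i).
Proof.
move=> hh; rewrite (_ : (fun s => _) = \sum_i h i); first exact: is_derive_sum.
by apply/funext => s; rewrite fct_sumE.
Qed.

Lemma is_derive_mulf (R : realType) (f g : R -> R) (df dg t : R) :
  is_derive t (1 : R) f df -> is_derive t (1 : R) g dg ->
  is_derive t (1 : R) (fun s => f s * g s) (f t * dg + g t * df).
Proof. exact: is_deriveM. Qed.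

Lemma is_derive_linear (R : realType) (v t : R) :
  is_derive t (1 : R) (fun s => v * s) v.
Proof.
have := is_derive_mulf (is_derive_cst v t (1 : R)) (is_derive_id t (1 : R)).
by rewrite mulr1 mulr0 addr0.
Qed.

Lemma is_derive_cstM (R : realType) (f : R -> R) (r df t : R) :
  is_derive t (1 : R) f df -> is_derive t (1 : R) (fun s => r * f s) (r * df).
Proof.
move=> hf; have := is_derive_mulf (is_derive_cst r t (1 : R)) hf.
by rewrite mulr0 addr0.
Qed.

Lemma sum_ord2 (R : realType) (F : 'I_2 -> R) : \sum_i F i = F re_ix + F im_ix.
Proof.
by rewrite big_ord_recl big_ord1; congr (F _ + F _); apply/val_inj.
Qed.

Definition polar_mx (R : realType) m (r th : 'I_m -> R) : 'M[R]_(2, m) :=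
  \matrix_(i, c) (r c * if i == re_ix then cos (th c) else sin (th c)).

Definition real_mx (R : realType) m (r : 'I_m -> R) : 'M[R]_(2, m) :=
  \matrix_(i, c) if i == re_ix then r c else 0.

Lemma polar_mx0 (R : realType) m (r : 'I_m -> R) :
  polar_mx r (fun=> 0) = real_mx r.
Proof.
by apply/matrixP => i c; rewrite !mxE; case: ifP => _; rewrite ?cos0 ?sin0 ?mulr1 ?mulr0.
Qed.

Lemma derive_ex_ey (R : realType) m (f : 'M[R]_(2, m) -> R) x v :
  differentiable f x ->
  'D_v f x = \sum_l (v re_ix l * 'D_(ex l) f x + v im_ix l * 'D_(ey l) f x).
Proof.
move=> df; rewrite diff_sum_delta// exchange_big/=.
by under eq_bigr do rewrite sum_ord2.
Qed.

Section TorusInvariantPsh.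
Variables (R : realType) (m : nat) (f : 'M[R]_(2, m) -> R).
Hypothesis f_diff : forall w, differentiable f w.
Hypothesis Df_diff : forall v w, differentiable ('D_v f) w.
Hypothesis f_torus : forall r th, f (polar_mx r th) = f (real_mx r).
(** Plurisubharmonicity tested on real vectors [v] only, where just the real parts of the Hessian
    entries contribute. *)
Hypothesis f_psh : forall w (v : 'I_m -> R), 0 <= \sum_l \sum_mu v l * v mu *
  ('D_(ex l) ('D_(ex mu) f) w + 'D_(ey l) ('D_(ey mu) f) w).

(* The circle [s |-> (r_c e^{i v_c s})_c] lies in one torus orbit, so the second
   derivative of [f] along it vanishes. *)
Lemma torus_second_derivative (r v : 'I_m -> R) :
  \sum_l v l ^+ 2 * r l * 'D_(ex l) f (real_mx r) =
  \sum_l \sum_mu (v l * r l) * (v mu * r mu) *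
    'D_(ey mu) ('D_(ey l) f) (real_mx r).
Proof.
pose g s := polar_mx r (fun c => v c * s).
pose dg s : 'M[R]_(2, m) := \matrix_(i, c)
  (r c * if i == re_ix then - (v c * sin (v c * s)) else v c * cos (v c * s)).
have hg s i c : is_derive s (1 : R) (fun s => g s i c) (dg s i c).
  rewrite mxE; under eq_fun do rewrite mxE.
  apply: is_derive_cstM; case: ifP => _.
    have := is_derive1_comp (is_derive_cos (v c * s)) (is_derive_linear (v c) s).
    by rewrite mulNr mulrC.
  have := is_derive1_comp (is_derive_sin (v c * s)) (is_derive_linear (v c) s).
  by rewrite mulrC.
have g0 : g 0 = real_mx r.
  by rewrite -polar_mx0; congr polar_mx; apply/funext => c; rewrite mulr0.
have Dg0 s : 'D_(dg s) f (g s) = 0.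
  have [_ <-] := curve_is_derive (f_diff (g s)) (hg s).
  rewrite (_ : f \o g = cst (f (real_mx r))) ?derive_cst//.
  by apply/funext => s'; rewrite /= /g f_torus.
pose a l s := - (v l * sin (v l * s)) * r l; pose b l s := v l * cos (v l * s) * r l.
have E s : \sum_l (a l s * 'D_(ex l) f (g s) + b l s * 'D_(ey l) f (g s)) = 0.
  rewrite -[RHS](Dg0 s) derive_ex_ey//; apply: eq_bigr => l _.
  by rewrite !mxE/= /a /b ![r l * _]mulrC.
have ha l : is_derive (0 : R) (1 : R) (a l) (- (v l ^+ 2 * r l)).
  rewrite (_ : a l = fun s => - (v l * r l) * sin (v l * s)); last first.
    by apply/funext => s; rewrite /a; ring.
  have := is_derive_cstM (- (v l * r l))
     (is_derive1_comp (is_derive_sin (v l * 0)) (is_derive_linear (v l) 0)).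
  by rewrite mulr0 cos0 mul1r (_ : _ * v l = - (v l ^+ 2 * r l))//; ring.
have hb l : is_derive (0 : R) (1 : R) (b l) 0.
  rewrite (_ : b l = fun s => (v l * r l) * cos (v l * s)); last first.
    by apply/funext => s; rewrite /b; ring.
  have := is_derive_cstM (v l * r l)
     (is_derive1_comp (is_derive_cos (v l * 0)) (is_derive_linear (v l) 0)).
  by rewrite mulr0 sin0 oppr0 mul0r mulr0.
(* The first derivative [E] vanishes for all [s]; it is differentiated once more at [s = 0]. There
   [a] and the derivative of [b] vanish, so only the [ey]-[ey] terms and the derivative of [a]
   survive. *)
have hE : is_derive (0 : R) (1 : R)
    (fun s => \sum_l (a l s * 'D_(ex l) f (g s) + b l s * 'D_(ey l) f (g s)))
    (\sum_l (a l 0 * 'D_(dg 0) ('D_(ex l) f) (g 0) + 'D_(ex l) f (g 0) * - (v l ^+ 2 * r l)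
      + (b l 0 * 'D_(dg 0) ('D_(ey l) f) (g 0) + 'D_(ey l) f (g 0) * 0))).
  apply: is_derive_sumf => l; apply: is_deriveD.
    exact: (is_derive_mulf (ha l) (curve_is_derive (Df_diff (ex l) (g 0)) (hg 0))).
  exact: (is_derive_mulf (hb l) (curve_is_derive (Df_diff (ey l) (g 0)) (hg 0))).
case: hE => _; rewrite (_ : (fun s => _) = cst 0); last by apply/funext => s; rewrite E.
rewrite derive_cst g0 => /esym /eqP.
have -> : \sum_l (a l 0 * 'D_(dg 0) ('D_(ex l) f) (real_mx r)
    + 'D_(ex l) f (real_mx r) * - (v l ^+ 2 * r l)
    + (b l 0 * 'D_(dg 0) ('D_(ey l) f) (real_mx r) + 'D_(ey l) f (real_mx r) * 0)) =
  \sum_l \sum_mu (v l * r l) * (v mu * r mu) * 'D_(ey mu) ('D_(ey l) f) (real_mx r)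
  - \sum_l v l ^+ 2 * r l * 'D_(ex l) f (real_mx r).
  rewrite -sumrB; apply: eq_bigr => l _.
  rewrite /a /b mulr0 sin0 cos0 mulr0 oppr0 mul0r mul0r add0r !mulr0 addr0 mulr1.
  rewrite addrC mulrN ['D_(ex l) f _ * _]mulrC; congr (_ - _).
  rewrite derive_ex_ey// mulr_sumr; apply: eq_bigr => mu _.
  by rewrite !mxE/= mulr0 sin0 cos0 mulr0 oppr0 mulr0 mul0r add0r mulr1; ring.
by rewrite subr_eq0 => /eqP ->.
Qed.

(** Along [t |-> r_c e^{v_c t}] the second derivative is the [ex]-[ex] Hessian form plus a
    first-order term. [torus_second_derivative] turns that term into the [ey]-[ey] form, so the
    total is nonnegative by [f_psh]: [f] is convex in the logarithms of the moduli, and the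
    inequality is its tangent bound from [t = 0] to [t = 1]. *)
Lemma log_tangent (r v : 'I_m -> R) :
  f (real_mx r) + \sum_l v l * r l * 'D_(ex l) f (real_mx r) <=
  f (real_mx (fun c => r c * expR (v c))).
Proof.
pose rho t c := r c * expR (v c * t).
pose g t : 'M[R]_(2, m) := real_mx (rho t).
pose dg t : 'M[R]_(2, m) := real_mx (fun c => v c * rho t c).
have hrho t c : is_derive t (1 : R) (fun t => rho t c) (v c * rho t c).
  rewrite /rho mulrCA; apply: is_derive_cstM.
  have := is_derive1_comp (is_derive_expR (v c * t)) (is_derive_linear (v c) t).
  by rewrite mulrC.
have hg t i c : is_derive t (1 : R) (fun t => g t i c) (dg t i c).
  rewrite mxE; under eq_fun do rewrite mxE.
  by case: ifP => _ //; exact: is_derive_cst.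
have Dg (h : 'M[R]_(2, m) -> R) t : differentiable h (g t) ->
    'D_(dg t) h (g t) = \sum_l v l * rho t l * 'D_(ex l) h (g t).
  by move=> dh; rewrite derive_ex_ey//; apply: eq_bigr => l _; rewrite !mxE/= mul0r addr0.
pose F' t := \sum_l v l * rho t l * 'D_(ex l) f (g t).
have hF t : is_derive t (1 : R) (f \o g) (F' t).
  by rewrite /F' -Dg//; exact: curve_is_derive.
pose F'' t := \sum_l (v l * rho t l * 'D_(dg t) ('D_(ex l) f) (g t) +
   'D_(ex l) f (g t) * (v l * (v l * rho t l))).
have hF' t : is_derive t (1 : R) F' (F'' t).
  apply: is_derive_sumf => l; have hv := is_derive_cstM (v l) (hrho t l).
  exact: (is_derive_mulf hv (curve_is_derive (Df_diff (ex l) (g t)) (hg t))).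
have F''ge0 t : 0 <= F'' t.
  apply: le_trans (f_psh (g t) (fun c => v c * rho t c)) _.
  (* Exchanging the sums matches the orders of differentiation, so symmetry of second derivatives is
     not invoked. *)
  rewrite exchange_big le_eqVlt; apply/orP; left; apply/eqP.
  rewrite /F'' big_split /=.
  transitivity (\sum_l \sum_mu v l * rho t l * (v mu * rho t mu) *
      'D_(ex mu) ('D_(ex l) f) (g t) + \sum_l \sum_mu v l * rho t l * (v mu * rho t mu) *
      'D_(ey mu) ('D_(ey l) f) (g t)).
    rewrite -big_split; apply: eq_bigr => l _; rewrite -big_split; apply: eq_bigr => mu _.
    by rewrite /= -mulrDr [v mu * _ * _]mulrC.
  congr (_ + _).
    apply: eq_bigr => l _; rewrite Dg// [RHS]mulr_sumr; apply: eq_bigr => mu _.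
    by rewrite [RHS]mulrA.
  rewrite -torus_second_derivative; apply: eq_bigr => l _.
  by rewrite [RHS]mulrC mulrA -expr2.
have [|c c01 E] := @MVT_segment R (f \o g) F' 0 1 ler01 (fun t _ => hF t).
  by apply: derivable_within_continuous => t _; case: (hF t).
have F'mono : F' 0 <= F' c.
  move: c01; rewrite in_itv/= => /andP[c0 c1].
  apply: (@ger0_derive1_ndecr R F' 0 1) => // [t _|].
  - by rewrite derive1E; case: (hF' t) => _ ->.
  - by apply: derivable_within_continuous => t _; case: (hF' t).
have g0 : g 0 = real_mx r.
  by congr real_mx; apply/funext => l; rewrite /rho mulr0 expR0 mulr1.
have -> : real_mx (fun c => r c * expR (v c)) = g 1.
  by congr real_mx; apply/funext => l; rewrite /rho mulr1.
move: E; rewrite subr0 mulr1 /= g0 => /eqP; rewrite subr_eq => /eqP ->.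
rewrite addrC lerD2r; apply: le_trans F'mono.
rewrite /F' g0 le_eqVlt; apply/orP; left.
by apply/eqP/eq_bigr => l _; rewrite /rho mulr0 expR0 mulr1.
Qed.

Definition upd (T : Type) (r : 'I_m -> T) (l : 'I_m) (t : T) : 'I_m -> T :=
  fun c => if c == l then t else r c.

(** In the [l]-th complex variable alone [f] is subharmonic and rotation invariant on the plane,
    hence nondecreasing in the radius. *)
Lemma coord_monotone (r : 'I_m -> R) (l : 'I_m) (s t : R) : 0 <= s -> s <= t ->
  f (real_mx (upd r l s)) <= f (real_mx (upd r l t)).
Proof.
pose g t : 'M[R]_(2, m) := real_mx (upd r l t).
have hg t' i c : is_derive t' (1 : R) (fun t => g t i c) ((ex l : 'M[R]_(2, m)) i c).
  rewrite /ex mxE; under eq_fun do rewrite mxE /upd.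
  case: (i == re_ix) => /=; last exact: is_derive_cst.
  by case: (c == l); [exact: is_derive_id|exact: is_derive_cst].
have hF t' : is_derive t' (1 : R) (f \o g) ('D_(ex l) f (g t')).
  exact: curve_is_derive.
(* [u' = t' (D_xx f + D_yy f) >= 0] and [u 0 = 0], so the radial derivative is nonnegative. *)
pose u t' := t' * 'D_(ex l) f (g t').
have hu t' : is_derive t' (1 : R) u
    (t' * 'D_(ex l) ('D_(ex l) f) (g t') + 'D_(ex l) f (g t') * 1).
  apply: is_derive_mulf.
  exact: (curve_is_derive (Df_diff (ex l) (g t')) (hg t')).
have pick (X : 'I_m -> R) : \sum_c (c == l)%:R * X c = X l.
  rewrite (bigD1 l)//= eqxx mul1r big1 ?addr0// => c /negbTE ->; by rewrite mul0r.
(* The torus identity with [v] the indicator of [l]: the angular part of the Laplacian is the radial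
   derivative divided by the radius. *)
have lap t' : t' * 'D_(ex l) f (g t') = t' ^+ 2 * 'D_(ey l) ('D_(ey l) f) (g t').
  have rl : upd r l t' l = t' by rewrite /upd eqxx.
  have := torus_second_derivative (upd r l t') (fun c => (c == l)%:R).
  under eq_bigr do rewrite expr2 -!mulrA.
  rewrite pick eqxx mul1r rl -/(g t') => ->.
  under eq_bigr => c _.
    under eq_bigr do rewrite [_%:R * _ * (_ * _)]mulrCA -mulrA.
    rewrite pick rl -mulrA -mulrA.
    over.
  by rewrite pick rl; ring.
have lap1 t' : 0 < t' ->
    'D_(ex l) f (g t') = t' * 'D_(ey l) ('D_(ey l) f) (g t').
  move=> t0; apply: (mulfI (lt0r_neq0 t0)); rewrite lap; ring.
have psh1 t' : 0 <= 'D_(ex l) ('D_(ex l) f) (g t') + 'D_(ey l) ('D_(ey l) f) (g t').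
  have := @f_psh (g t') (fun c => (c == l)%:R).
  under eq_bigr => c _.
    under eq_bigr do rewrite -mulrA mulrCA.
    rewrite pick.
    over.
  by rewrite pick.
have u_ge0 t' : 0 <= t' -> 0 <= u t'.
  move=> t0; have <- : u 0 = 0 by rewrite /u mul0r.
  apply: (@ger0_derive1_ndecry R u 0) => // [x|].
  - rewrite in_itv/= andbT => x0; rewrite derive1E; case: (hu x) => _ ->.
    by rewrite mulr1 lap1// -mulrDr mulr_ge0// ltW.
  - by apply: derivable_within_continuous => x _; case: (hu x).
move=> s0 st; apply: (@ger0_derive1_ndecry R (f \o g) 0) => // [x|].
- rewrite in_itv/= andbT => x0; rewrite derive1E; case: (hF x) => _ ->.
  by rewrite -(pmulr_rge0 _ x0); apply: u_ge0; exact: ltW.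
- by apply: derivable_within_continuous => x _; case: (hF x).
Qed.

(** The coordinates are raised to [1] one at a time, along a list that finally contains all of
    them. *)
Lemma unit_cube_le (r : 'I_m -> R) : (forall c, 0 <= r c <= 1) ->
  f (real_mx r) <= f (real_mx (fun=> 1)).
Proof.
move=> hr.
have H (s : seq 'I_m) : f (real_mx r) <= f (real_mx (fun c => if c \in s then 1 else r c)).
  elim: s => [|l s IH]; first by [].
  apply: (le_trans IH).
  set r' := (fun c => if c \in s then 1 else r c).
  have r'l : 0 <= r' l <= 1 by rewrite /r'; case: ifP => _ //; rewrite ler01 lexx.
  have [l0 l1] := andP r'l.
  have := coord_monotone r' l l0 l1.
  rewrite (_ : upd r' l (r' l) = r'); last first.
    by apply/funext => c; rewrite /upd; case: eqP => // ->.
  rewrite (_ : upd r' l 1 = (fun c => if c \in l :: s then 1 else r c))//.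
  by apply/funext => c; rewrite /upd in_cons; case: eqP.
apply: (le_trans (H (enum 'I_m))); rewrite (_ : (fun c => _) = fun=> 1)//.
by apply/funext => c; rewrite mem_enum.
Qed.

End TorusInvariantPsh.

(** * The Fubini-Study potential *)

Definition mxdot (R : realType) m (w v : 'M[R]_(2, m)) : R :=
  \sum_(r < 2) \sum_(c < m) w r c * v r c.

Lemma mxdotDl (R : realType) m (w u v : 'M[R]_(2, m)) (t : R) :
  mxdot (w + t *: u) v = mxdot w v + t * mxdot u v.
Proof.
rewrite /mxdot mulr_sumr -big_split; apply: eq_bigr => i _.
rewrite mulr_sumr -big_split; apply: eq_bigr => j _ /=.
by rewrite !mxE; ring.
Qed.

Lemma sqnorm_dot (R : realType) m (w : 'M[R]_(2, m)) : sqnorm w = mxdot w w.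
Proof. by []. Qed.

Lemma mxdotC (R : realType) m (w v : 'M[R]_(2, m)) : mxdot w v = mxdot v w.
Proof. by apply: eq_bigr => i _; apply: eq_bigr => j _; rewrite mulrC. Qed.

Lemma sqnorm_line (R : realType) m (w v : 'M[R]_(2, m)) (t : R) :
  sqnorm (w + t *: v) = sqnorm w + 2 * mxdot w v * t + sqnorm v * (t * t).
Proof.
rewrite !sqnorm_dot mxdotDl [mxdot w (_ + _)]mxdotC [mxdot v (_ + _)]mxdotC !mxdotDl.
by rewrite [mxdot v w]mxdotC; ring.
Qed.

Lemma sqnorm_ge0 (R : realType) m (w : 'M[R]_(2, m)) : 0 <= sqnorm w.
Proof. by apply: sumr_ge0 => i _; apply: sumr_ge0 => j _; exact: sqr_ge0. Qed.

Lemma sqnorm1_gt0 (R : realType) m (w : 'M[R]_(2, m)) : 0 < 1 + sqnorm w.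
Proof. by rewrite ltr_pwDl// sqnorm_ge0. Qed.

Lemma differentiable_dot (R : realType) m (v w : 'M[R]_(2, m)) :
  differentiable (fun w : 'M[R]_(2, m) => mxdot w v) w.
Proof.
rewrite (_ : (fun w => mxdot w v) = \sum_(r < 2) \sum_(c < m)
   (fun w : 'M[R]_(2, m) => w r c * v r c)); last first.
  by apply/funext => u; rewrite fct_sumE; apply: eq_bigr => i _; rewrite fct_sumE.
apply: differentiable_sum => i; apply: differentiable_sum => j.
by apply: differentiableM; [exact: differentiable_coord|exact: differentiable_cst].
Qed.

Lemma differentiable_sqnorm (R : realType) m (w : 'M[R]_(2, m)) :
  differentiable (@sqnorm R m) w.
Proof.
rewrite (_ : @sqnorm R m = \sum_(r < 2) \sum_(c < m)
   (fun w : 'M[R]_(2, m) => w r c * w r c)); last first.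
  by apply/funext => u; rewrite fct_sumE; apply: eq_bigr => i _; rewrite fct_sumE.
apply: differentiable_sum => i; apply: differentiable_sum => j.
by apply: differentiableM; exact: differentiable_coord.
Qed.

Lemma differentiable_sqnorm1 (R : realType) m (w : 'M[R]_(2, m)) :
  differentiable (fun w : 'M[R]_(2, m) => 1 + sqnorm w) w.
Proof.
by apply: differentiableD; [exact: differentiable_cst|exact: differentiable_sqnorm].
Qed.

Lemma fs_differentiable (R : realType) m (a : R) (w : 'M[R]_(2, m)) :
  differentiable (fs_potential a) w.
Proof.
apply: differentiableM; first exact: differentiable_cst.
apply: (differentiable_comp (differentiable_sqnorm1 w)).
by apply/derivable1_diffP; case: (is_derive1_ln (sqnorm1_gt0 w)).
Qed.

Lemma derive_along_line (R : realType) (V : normedModType R) (f : V -> R) (w v : V) d :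
  is_derive (0 : R) (1 : R) (fun t => f (w + t *: v)) d -> 'D_v f w = d.
Proof.
case=> _ <-; have [|_] := @derivable_affine R R V f (fun t => w + t *: v) 0 1 v.
  by move=> h; rewrite addr0 scale0r addr0 addrC /GRing.scale/= mulr1.
by rewrite scale0r addr0.
Qed.

Lemma is_derive_quad0 (R : realType) (a b c : R) :
  is_derive (0 : R) (1 : R) (fun t => a + b * t + c * (t * t)) b.
Proof.
have h1 := is_derive_linear b 0.
have h2 := is_derive_cstM c (is_derive_mulf (is_derive_id (0 : R) (1 : R))
  (is_derive_id (0 : R) (1 : R))).
have := is_deriveD (is_deriveD (is_derive_cst a (0 : R) (1 : R)) h1) h2.
by rewrite !mul0r !addr0 mulr0 addr0 add0r.
Qed.

(** On a line [sqnorm] is a quadratic polynomial in the parameter, so this is one-variable calculus;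
    the second derivatives follow in the same way. *)
Lemma fs_derive (R : realType) m (a : R) (w v : 'M[R]_(2, m)) :
  'D_v (fs_potential a) w = 2 * a * mxdot w v / (1 + sqnorm w).
Proof.
apply: derive_along_line; rewrite /fs_potential.
under eq_fun do rewrite sqnorm_line !addrA.
pose q t := 1 + sqnorm w + 2 * mxdot w v * t + sqnorm v * (t * t).
have q0 : is_derive (0 : R) (1 : R) q (2 * mxdot w v) by exact: is_derive_quad0.
have qE : q 0 = 1 + sqnorm w by rewrite /q !mulr0 !addr0.
have s0 : 0 < q 0 by rewrite qE sqnorm1_gt0.
have := is_derive_cstM a (is_derive1_comp (is_derive1_ln s0) q0).
by move/is_derive_eq; apply; rewrite qE; ring.
Qed.

Lemma fs_derive2 (R : realType) m (a : R) (w u v : 'M[R]_(2, m)) :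
  'D_u ('D_v (fs_potential a)) w =
  2 * a * (mxdot u v / (1 + sqnorm w)
           - 2 * mxdot w u * mxdot w v / (1 + sqnorm w) ^+ 2).
Proof.
rewrite (_ : 'D_v (fs_potential a) =
  fun w => 2 * a * mxdot w v * (1 + sqnorm w)^-1); last first.
  by apply/funext => z; rewrite fs_derive.
apply: derive_along_line.
under eq_fun do rewrite sqnorm_line !addrA mxdotDl.
pose q t := 1 + sqnorm w + 2 * mxdot w u * t + sqnorm u * (t * t).
have q0 : is_derive (0 : R) (1 : R) q (2 * mxdot w u) by exact: is_derive_quad0.
have qE : q 0 = 1 + sqnorm w by rewrite /q !mulr0 !addr0.
have s0 : q 0 != 0 by rewrite qE gt_eqF// sqnorm1_gt0.
have s1 : 1 + sqnorm w != 0 by rewrite gt_eqF// sqnorm1_gt0.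
have l0 : is_derive (0 : R) (1 : R) (fun t => mxdot w v + t * mxdot u v) (mxdot u v).
  have := is_derive_quad0 (mxdot w v) (mxdot u v) 0.
  by under eq_fun do rewrite mul0r addr0 mulrC.
have := is_derive_mulf (is_derive_cstM (2 * a) l0) (is_deriveV s0 q0).
move/is_derive_eq; apply; rewrite /GRing.scale/= ?exprVn mul0r addr0.
by rewrite qE; field.
Qed.

Lemma fs_derive_differentiable (R : realType) m (a : R) (v w : 'M[R]_(2, m)) :
  differentiable ('D_v (fs_potential a)) w.
Proof.
rewrite (_ : 'D_v (fs_potential a) =
  (fun w => 2 * a * mxdot w v) * (fun w => (1 + sqnorm w)^-1)); last first.
  by apply/funext => z; rewrite fs_derive.
apply: differentiableM.
  by apply: differentiableM; [exact: differentiable_cst|exact: differentiable_dot].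
apply: differentiableV; first exact: differentiable_sqnorm1.
by rewrite gt_eqF// sqnorm1_gt0.
Qed.

Lemma mxdot_ex (R : realType) m (w : 'M[R]_(2, m)) l : mxdot w (ex l) = w re_ix l.
Proof.
rewrite /mxdot sum_ord2 [X in _ + X]big1 ?addr0; last first.
  by move=> c _; rewrite mxE mulr0.
rewrite (bigD1 l)//= mxE !eqxx mulr1 big1 ?addr0// => c /negbTE cl.
by rewrite mxE cl andbF mulr0.
Qed.

Lemma mxdot_ey (R : realType) m (w : 'M[R]_(2, m)) l : mxdot w (ey l) = w im_ix l.
Proof.
rewrite /mxdot sum_ord2 [X in X + _]big1 ?add0r; last first.
  by move=> c _; rewrite mxE mulr0.
rewrite (bigD1 l)//= mxE !eqxx mulr1 big1 ?addr0// => c /negbTE cl.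
by rewrite mxE cl andbF mulr0.
Qed.

(** The bordered matrix with identity diagonal blocks and off-diagonal blocks [v], [u] is factored
    through either Schur complement; the two determinants agree. *)
Lemma det_1_sub_mul (F : comRingType) m (u : 'cV[F]_m) (v : 'rV[F]_m) :
  \det (1%:M - u *m v) = 1 - (v *m u) 0 0.
Proof.
have E1 : block_mx 1%:M v u 1%:M =
    block_mx 1%:M 0 u 1%:M *m block_mx (1%:M : 'M[F]_1) v 0 (1%:M - u *m v).
  rewrite mulmx_block !(mul1mx, mul0mx, mulmx1, mulmx0, addr0, add0r).
  by rewrite addrC subrK.
have E2 : block_mx 1%:M v u 1%:M =
    block_mx 1%:M v 0 1%:M *m block_mx ((1%:M : 'M[F]_1) - v *m u) 0 u 1%:M.
  rewrite mulmx_block !(mul1mx, mul0mx, mulmx1, mulmx0, addr0, add0r).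
  by rewrite subrK.
have := congr1 determinant E1; rewrite {1}E2 !det_mulmx !det_ublock !det_lblock !det1.
by rewrite !mul1r !mulr1 => <-; rewrite [_ - _]mx11_scalar det_scalar1 !mxE.
Qed.

(** With [S = 1 + |w|^2] the Hessian is [a / S] times the identity minus the rank-one matrix with
    entries [conj(w_l) w_mu / S]. Its determinant is [(a / S)^m (1 - |w|^2 / S)], and the last
    factor is [1 / S]. *)
Lemma vol_densityE (R : realType) m (a : R) (w : 'M[R]_(2, m)) :
  vol_density a w = a ^+ m / (1 + sqnorm w) ^+ m.+1.
Proof.
rewrite /vol_density; set S := 1 + sqnorm w.
have S0 : S != 0 by rewrite gt_eqF// sqnorm1_gt0.
pose u : 'cV[R[i]]_m := \col_l Complex (w re_ix l / S) (- (w im_ix l / S)).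
pose v : 'rV[R[i]]_m := \row_l Complex (w re_ix l) (w im_ix l).
have -> : cplx_hessian (fs_potential a) w = (a / S)%:C%C *: (1%:M - u *m v).
  apply/matrixP => l mu; rewrite !mxE big_ord1 !mxE !fs_derive2 !mxdot_ex !mxdot_ey !mxE -/S.
  rewrite !eqxx/= [l == mu]eq_sym; case: eqP => _ /=;
    apply/eqP; rewrite eq_complex/= ?mulr1n ?mulr0n/=; apply/andP; split; apply/eqP; by field.
rewrite detZ det_1_sub_mul mxE.
have -> : \sum_j v 0 j * u j 0 = (sqnorm w / S)%:C%C.
  rewrite sqnorm_dot /mxdot exchange_big mulr_suml rmorph_sum/=; apply: eq_bigr => j _.
  rewrite !mxE sum_ord2; apply/eqP; rewrite eq_complex/=; apply/andP; split; apply/eqP; by field.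
have -> : 1 - (sqnorm w / S)%:C%C = (S^-1)%:C%C :> R[i].
  apply/eqP; rewrite eq_complex/= subr0 eqxx andbT; apply/eqP.
  by move: S0; rewrite /S => S0; field.
rewrite -rmorphXn -rmorphM/= exprMn exprVn exprS invfM.
by rewrite mulrA [RHS]mulrAC.
Qed.

(** * Affine charts and polar coordinates *)

(** The linear part of the affine map [chart j]. *)
Definition tangent_chart {R : realType} {m : nat} (j : 'I_m.+1) (v : 'M[R]_(2, m))
  : 'M[R]_(2, m.+1) :=
  \matrix_(r, c) match unlift j c with Some c' => v r c' | None => 0 end.

Lemma chart_affine (R : realType) m (j : 'I_m.+1) (v w : 'M[R]_(2, m)) (h : R) :
  chart j (h *: v + w) = h *: tangent_chart j v + chart j w.
Proof.
apply/matrixP => r c; rewrite !mxE; case: unlift => [c'|]; first by rewrite !mxE.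
by rewrite mulr0 add0r.
Qed.

Lemma chart_neq0 (R : realType) m (j : 'I_m.+1) (w : 'M[R]_(2, m)) : chart j w != 0.
Proof.
apply/eqP => /matrixP/(_ re_ix j)/eqP.
by rewrite !mxE unlift_none eqxx oner_eq0.
Qed.

Lemma chart_continuous (R : realType) m (j : 'I_m.+1) (w : 'M[R]_(2, m)) :
  {for w, continuous (@chart R m j)}.
Proof.
move=> A /nbhs_ballP[e /= e0 eA]; apply/nbhs_ballP; exists e => //= w'.
rewrite -ball_normE /ball_/= => we; apply: eA; rewrite -ball_normE /ball_/=.
apply: le_lt_trans we.
rewrite [leLHS]/Num.Def.normr/= mx_normrE; apply: bigmax_le => //= -[r c] _ /=.
rewrite !mxE; case: unlift => [c'|]; last by rewrite subrr normr0.
by have := mx_entry_norm_le (w - w') r c'; rewrite !mxE.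
Qed.

Lemma near_neq0 (R : realType) (V : normedModType R) (x : V) :
  x != 0 -> \forall y \near x, y != 0.
Proof.
move=> x0; apply/nbhs_ballP; exists `|x| => /=; first by rewrite normr_gt0.
move=> y; rewrite -ball_normE /ball_/=; apply: contraTneq => ->.
by rewrite subr0 ltxx.
Qed.

Lemma Re_mul_real_conj (R : realType) (A B x y : R) :
  complex.Re (Complex A B * x%:C%C * (y%:C%C)^* : R[i]) = A * x * y.
Proof. by rewrite /= !(mulr0, mul0r, subr0, oppr0, add0r, addr0). Qed.

Section SmoothChart.
Variables (R : realType) (m : nat) (Phi : 'M[R]_(2, m.+1) -> R).
Hypothesis Phi_smooth : smooth_on [set Z | Z != 0] Phi.

Lemma diter_differentiable vs (Z : 'M[R]_(2, m.+1)) :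
  Z != 0 -> differentiable (diter Phi vs) Z.
Proof.
move=> Z0; apply: C1_differentiable => [|v].
  have := near_neq0 Z0; apply: filterS => Y Y0 v.
  by have [+ _] := Phi_smooth vs; apply.
by have [_ +] := Phi_smooth (v :: vs); apply.
Qed.

(** Derivatives of a pulled-back [diter] are again pulled-back [diter]s, so [smooth_on] passes to
    the charts for every order at once. *)
Lemma diter_chart_derive vs j (v : 'M[R]_(2, m)) :
  'D_v (diter Phi vs \o chart j) = diter Phi (tangent_chart j v :: vs) \o chart j.
Proof.
apply/funext => w.
by have [] := derivable_affine (diter Phi vs) (fun h => chart_affine j v w h).
Qed.

Lemma diter_chart_differentiable vs j (w : 'M[R]_(2, m)) :
  differentiable (diter Phi vs \o chart j) w.
Proof.
apply: C1_differentiable => [|v].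
  apply: filterE => y v.
  have [[_ +] _] := derivable_affine (diter Phi vs) (fun h => chart_affine j v y h).
  apply; have [+ _] := Phi_smooth vs; apply; exact: chart_neq0.
rewrite diter_chart_derive; apply: continuous_comp; first exact: chart_continuous.
by have [_ +] := Phi_smooth (tangent_chart j v :: vs); apply; exact: chart_neq0.
Qed.

(** For [a = N] this is [Psi] of the overview restricted to the slice [z_j = 1], where
    [|Z|^2 = 1 + |w|^2]. *)
Definition local_potential (a : R) j (w : 'M[R]_(2, m)) := fs_potential a w + Phi (chart j w).

Lemma local_potential_differentiable a j w : differentiable (local_potential a j) w.
Proof.
apply: differentiableD; first exact: fs_differentiable.
exact: (diter_chart_differentiable [::]).
Qed.

Lemma local_potential_derive a j v w : 'D_v (local_potential a j) w =
  'D_v (fs_potential a) w + 'D_(tangent_chart j v) Phi (chart j w).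
Proof.
rewrite /local_potential deriveD; last 2 first.
- exact/diff_derivable/fs_differentiable.
- exact/diff_derivable/(diter_chart_differentiable [::]).
by congr (_ + _); have /(congr1 (fun F => F w)) := diter_chart_derive [::] j v.
Qed.

Lemma local_potential_derive_differentiable a j v w :
  differentiable ('D_v (local_potential a j)) w.
Proof.
rewrite (_ : 'D_v _ = 'D_v (fs_potential a) + (diter Phi [:: tangent_chart j v] \o chart j)).
  apply: differentiableD; first exact: fs_derive_differentiable.
  exact: diter_chart_differentiable.
by apply/funext => x; rewrite local_potential_derive.
Qed.

Lemma local_potential_psh a j w (v : 'I_m -> R) : admissible a Phi ->
  0 <= \sum_l \sum_mu v l * v mu *
    ('D_(ex l) ('D_(ex mu) (local_potential a j)) w +
     'D_(ey l) ('D_(ey mu) (local_potential a j)) w).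
Proof.
move=> adm; pose xi : 'rV[R[i]]_m := \row_l (v l)%:C%C.
(* Positive definiteness says nothing about the zero vector, but the sum then vanishes. *)
have [xi0|xi0] := eqVneq xi 0.
  rewrite big1// => l _; rewrite big1// => mu _.
  have /rowP/(_ l) := xi0; rewrite !mxE => /(congr1 (@complex.Re R))/= ->.
  by rewrite !mul0r.
(* The order on [R[i]] compares real parts and requires equal imaginary parts; only the real part is
   kept. It carries the factor [1 / 4] of [cplx_hessian]. *)
have := adm j w _ xi0; rewrite ltcE => /andP[_] /=.
rewrite raddf_sum => /ltW; set s := \sum_(l < m) _.
suff -> : s = (\sum_l \sum_mu v l * v mu *
    ('D_(ex l) ('D_(ex mu) (local_potential a j)) w +
     'D_(ey l) ('D_(ey mu) (local_potential a j)) w)) / 4.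
  by rewrite pmulr_lge0// invr_gt0.
rewrite mulr_suml; apply: eq_bigr => l _; rewrite raddf_sum mulr_suml.
apply: eq_bigr => mu _; rewrite !mxE.
apply: etrans (Re_mul_real_conj _ _ _ _) _.
by rewrite -mulrA mulrC mulrA.
Qed.

End SmoothChart.

Lemma polar_mx_neq0 (R : realType) m (r th : 'I_m -> R) :
  real_mx r != 0 -> polar_mx r th != 0.
Proof.
apply: contraNneq => /matrixP E; apply/eqP/matrixP => i c; rewrite !mxE.
case: ifP => // _; have := E re_ix c; have := E im_ix c; rewrite !mxE/= => Es Ec.
have : (r c * cos (th c)) ^+ 2 + (r c * sin (th c)) ^+ 2 = 0.
  by rewrite Es Ec expr0n addr0.
by rewrite !exprMn -mulrDr cos2Dsin2 mulr1 => /eqP; rewrite sqrf_eq0 => /eqP.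
Qed.

Lemma rotZ_polar (R : realType) m (l : 'I_m.+1) (r th : 'I_m.+1 -> R) (t : R) :
  rotZ l t (polar_mx r th) = polar_mx r (upd th l (th l + t)).
Proof.
apply/matrixP => i c; rewrite !mxE /upd.
have -> : ((c : nat) == l) = (c == l) by [].
case: eqP => [->|//] /=; case: ifP => _; rewrite ?cosD ?sinD; ring.
Qed.

Lemma sqnorm_polar (R : realType) m (r th : 'I_m -> R) :
  sqnorm (polar_mx r th) = \sum_c r c ^+ 2.
Proof.
rewrite sqnorm_dot /mxdot exchange_big; apply: eq_bigr => c _.
rewrite sum_ord2 !mxE/= -!expr2 !exprMn -mulrDr cos2Dsin2 mulr1//.
Qed.

Lemma sqnorm_real (R : realType) m (r : 'I_m -> R) :
  sqnorm (real_mx r) = \sum_c r c ^+ 2.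
Proof. by rewrite -polar_mx0 sqnorm_polar. Qed.

Lemma polar_coords (R : realType) (x y : R) :
  exists th, x = Num.sqrt (x ^+ 2 + y ^+ 2) * cos th /\
             y = Num.sqrt (x ^+ 2 + y ^+ 2) * sin th.
Proof.
set rho := Num.sqrt _.
have q0 : 0 <= x ^+ 2 + y ^+ 2 by rewrite addr_ge0// sqr_ge0.
have rho2 : rho ^+ 2 = x ^+ 2 + y ^+ 2 by rewrite sqr_sqrtr.
have rho0 : 0 <= rho by exact: sqrtr_ge0.
have [r0|r0] := eqVneq rho 0.
  exists 0; move: rho2; rewrite r0 expr0n/= => /esym/eqP.
  rewrite paddr_eq0 ?sqr_ge0// !sqrf_eq0 => /andP[/eqP-> /eqP->].
  by rewrite !mul0r.
have rp : 0 < rho by rewrite lt_neqAle eq_sym r0.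
have xr : -1 <= x / rho <= 1.
  rewrite -ler_norml normrM [`|rho^-1|]ger0_norm ?invr_ge0// ler_pdivrMr// mul1r.
  by rewrite -(@ler_pXn2r _ 2)// ?nnegrE// real_normK ?num_real// rho2 lerDl sqr_ge0.
have xE : x = rho * cos (acos (x / rho)).
  by rewrite acosK ?in_itv//= mulrC divfK.
have yE : `|y| = rho * sin (acos (x / rho)).
  rewrite sin_acos//.
  have -> : 1 - (x / rho) ^+ 2 = (y / rho) ^+ 2.
    rewrite !expr_div_n rho2 -[1](@divff _ (rho ^+ 2)) ?sqrf_eq0// rho2 -mulrBl.
    by rewrite [_ + y ^+ 2]addrC addrK.
  rewrite sqrtr_sqr normrM [`|rho^-1|]ger0_norm ?invr_ge0// mulrC divfK//.
(* [acos] yields an angle with nonnegative sine, so points of the lower half-plane take the opposite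
   angle. *)
have [y0|y0] := leP 0 y.
  by exists (acos (x / rho)); split => //; rewrite -yE ger0_norm.
exists (- acos (x / rho)); rewrite cosN sinN mulrN -yE ltr0_norm// opprK.
by split.
Qed.

Lemma polar_decomposition (R : realType) m (Z : 'M[R]_(2, m)) :
  exists r th : 'I_m -> R, (forall c, r c = Num.sqrt (Z re_ix c ^+ 2 + Z im_ix c ^+ 2)) /\
    Z = polar_mx r th.
Proof.
have [th hth] := choice (fun c => polar_coords (Z re_ix c) (Z im_ix c)).
exists (fun c => Num.sqrt (Z re_ix c ^+ 2 + Z im_ix c ^+ 2)), th; split => //.
apply/matrixP => i c; rewrite mxE.
have [h1 h2] := hth c; case: ifP => [/eqP -> //|ire].
suff -> : i = im_ix by [].
by apply/val_inj; move: ire; case: i => [[|[|]]].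
Qed.

(** * Bounds on the potential *)

(** The counterpart of [chart j] in polar coordinates: the inserted entry [d] is [1] for moduli and
    [0] for angles. *)
Definition chart_ext (R : realType) m (j : 'I_m.+1) (d : R) (x : 'I_m -> R) : 'I_m.+1 -> R :=
  fun c => match unlift j c with Some c' => x c' | None => d end.

Lemma chart_polar (R : realType) m (j : 'I_m.+1) (r th : 'I_m -> R) :
  chart j (polar_mx r th) = polar_mx (chart_ext j 1 r) (chart_ext j 0 th).
Proof.
apply/matrixP => i c; rewrite !mxE /chart_ext; case: unlift => [c'|]; first by rewrite mxE.
by case: ifP => _; rewrite ?cos0 ?sin0 mul1r.
Qed.

Lemma chart_real (R : realType) m (j : 'I_m.+1) (r : 'I_m -> R) :
  chart j (real_mx r) = real_mx (chart_ext j 1 r).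
Proof.
apply/matrixP => i c; rewrite !mxE /chart_ext; case: unlift => [c'|]; first by rewrite mxE.
by case: ifP => _.
Qed.

Lemma chart_real1 (R : realType) m (j : 'I_m.+1) :
  chart j (real_mx (fun=> 1)) = real_mx (fun=> 1) :> 'M[R]_(2, m.+1).
Proof.
by rewrite chart_real; congr real_mx; apply/funext => c; rewrite /chart_ext; case: unlift.
Qed.

Lemma real_mx_neq0 (R : realType) m (r : 'I_m -> R) (c : 'I_m) : r c != 0 -> real_mx r != 0.
Proof. by apply: contraNneq => /matrixP/(_ re_ix c); rewrite !mxE/= => ->. Qed.

Lemma cscale_real (R : realType) m (r : 'I_m -> R) (s : R) :
  Defs.cscale s 0 (real_mx r) = real_mx (fun c => s * r c).
Proof.
apply/matrixP => i c; rewrite !mxE/=; case: ifP => _; first by rewrite mul0r subr0.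
by rewrite mulr0 mul0r addr0.
Qed.

Section PotentialBounds.
Variables (R : realType) (m : nat) (Phi : 'M[R]_(2, m.+1) -> R).
Let a : R := m.+1%:R.
Let one : 'M[R]_(2, m.+1) := real_mx (fun=> 1).
Hypothesis Phi_proj : proj_invariant Phi.
Hypothesis Phi_smooth : smooth_on [set Z | Z != 0] Phi.
Hypothesis Phi_adm : admissible a Phi.
Hypothesis Phi_rot : forall (p : 'I_m.+1) th Z, Z != 0 -> Phi (rotZ p th Z) = Phi Z.
Hypothesis Phi_sym : forall c c' : 'I_m.+1,
  'D_(delta_mx re_ix c) Phi one = 'D_(delta_mx re_ix c') Phi one.

(** The angles are switched on one coordinate at a time, each by a single [rotZ]. *)
Lemma Phi_polar (r th : 'I_m.+1 -> R) : real_mx r != 0 ->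
  Phi (polar_mx r th) = Phi (real_mx r).
Proof.
move=> r0.
have H (s : seq 'I_m.+1) :
    Phi (polar_mx r (fun c => if c \in s then th c else 0)) = Phi (real_mx r).
  elim: s => [|l s <-]; first by rewrite polar_mx0.
  have [ls|ls] := boolP (l \in s).
    congr (Phi (polar_mx r _)); apply/funext => c; rewrite in_cons.
    by case: eqP => [->|//]; rewrite ls.
  rewrite -[RHS](Phi_rot l (th l)); last exact: polar_mx_neq0.
  rewrite rotZ_polar (negbTE ls) add0r.
  congr (Phi (polar_mx r _)); apply/funext => c; rewrite in_cons /upd.
  by case: eqP => [->|].
rewrite -[RHS](H (enum 'I_m.+1)); congr (Phi (polar_mx r _)).
by apply/funext => c; rewrite mem_enum.
Qed.

Lemma chart_ext_neq0 j (r : 'I_m -> R) : real_mx (chart_ext j 1 r) != 0.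
Proof. by rewrite -chart_real; exact: chart_neq0. Qed.

Lemma local_potential_torus j (r th : 'I_m -> R) :
  local_potential Phi a j (polar_mx r th) = local_potential Phi a j (real_mx r).
Proof.
rewrite /local_potential /fs_potential sqnorm_polar sqnorm_real chart_polar chart_real.
by rewrite Phi_polar// chart_ext_neq0.
Qed.

Lemma one_neq0 : one != 0.
Proof. by apply: (@real_mx_neq0 _ _ _ ord0); rewrite oner_eq0. Qed.

(** [Phi] is constant along real multiples of [one], so its derivative in the direction [one] is
    zero. That derivative is the sum of [m.+1] equal partial derivatives. *)
Lemma Phi_grad_one (c : 'I_m.+1) : 'D_(delta_mx re_ix c) Phi one = 0.
Proof.
have dPhi : differentiable Phi one := diter_differentiable Phi_smooth [::] one_neq0.
have radial : 'D_one Phi one = 0.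
  apply: derive_along_line.
  apply: (@near_eq_is_derive R R R (cst (Phi one))).
  (* For [|t| < 1] the scalar [1 + t] is nonzero, as [Phi_proj] requires. *)
  have : \forall t \near (0 : R), `|t| < 1 by apply: nbhs0_lt; exact: ltr01.
  apply: filterS => t t1 /=.
    have t0 : 1 + t != 0.
      by rewrite gt_eqF//; move: t1; rewrite ltr_norml; lra.
    rewrite -(@Phi_proj (1 + t) 0 one) ?one_neq0//; last first.
      by apply: contra t0 => /eqP[->].
    congr Phi; rewrite cscale_real; apply/matrixP => i j; rewrite !mxE.
    by case: ifP => _; rewrite ?mulr1// mulr0 addr0.
have := diff_sum_delta one dPhi; rewrite radial sum_ord2 [X in _ + X]big1 ?addr0; last first.
  by move=> j _; rewrite mxE mul0r.
rewrite (eq_bigr (fun=> 'D_(delta_mx re_ix c) Phi one)); last first.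
  by move=> j _; rewrite mxE/= mul1r; exact: Phi_sym.
rewrite sumr_const card_ord => /esym/eqP; rewrite mulrn_eq0/= => /eqP //.
Qed.

Lemma tangent_chart_ex j (l : 'I_m) :
  tangent_chart j (ex l) = delta_mx re_ix (lift j l) :> 'M[R]_(2, m.+1).
Proof.
apply/matrixP => i c; rewrite !mxE; case: unliftP => [c' ->|->].
  by rewrite mxE (inj_eq (@lift_inj _ j)).
by rewrite (negbTE (neq_lift j l)) andbF.
Qed.

(** Only the Fubini-Study term contributes, namely [2 a / (1 + m)]; the normalisation [a = m + 1]
    makes it [2]. *)
Lemma local_potential_grad_one j (l : 'I_m) :
  'D_(ex l) (local_potential Phi a j) (real_mx (fun=> 1)) = 2.
Proof.
rewrite local_potential_derive// chart_real1 tangent_chart_ex Phi_grad_one addr0.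
rewrite fs_derive mxdot_ex mxE/= mulr1 sqnorm_real expr1n sumr_const card_ord -/a.
have -> : 1 + 1 *+ m = a :> R by rewrite -mulrS.
by rewrite -mulrA divff ?mulr1// pnatr_eq0.
Qed.

(** [log_tangent] at the point [(1,..,1)] of the chart [z_0 = 1], in the direction [v = ln r]. *)
Lemma Phi_lower (r : 'I_m -> R) : (forall l, 0 < r l) ->
  a * ln a + Phi one + 2 * \sum_l ln (r l) <=
  a * ln (1 + \sum_l r l ^+ 2) + Phi (chart ord0 (real_mx r)).
Proof.
move=> r0.
have := log_tangent (local_potential_differentiable Phi_smooth a ord0)
  (local_potential_derive_differentiable Phi_smooth a ord0)
  (local_potential_torus ord0)
  (fun w v => local_potential_psh ord0 w v Phi_adm)
  (fun=> 1) (fun l => ln (r l)).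
rewrite (_ : (fun c => 1 * expR (ln (r c))) = r); last first.
  by apply/funext => c; rewrite mul1r lnK// posrE.
under eq_bigr do rewrite local_potential_grad_one mulr1 mulrC.
rewrite -mulr_sumr /local_potential /fs_potential !sqnorm_real chart_real1.
rewrite expr1n sumr_const card_ord.
by have -> : 1 + 1 *+ m = a :> R by rewrite -mulrS.
Qed.

(** In the chart of a coordinate of largest modulus the moduli lie in the unit cube, where
    [unit_cube_le] compares the point with [(1,..,1)]. The Fubini-Study term at the point is
    nonnegative and is dropped. *)
Lemma Phi_upper Z : Z != 0 -> Phi Z <= Phi one + a * ln a.
Proof.
have [r [th [rE ->]]] := polar_decomposition Z.
move=> Z0; have rge0 c : 0 <= r c by rewrite rE sqrtr_ge0.
pose j := [arg max_(i > ord0) r i]%O.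
have rj c : r c <= r j by rewrite /j; case: arg_maxP => //= i _; apply.
have rj0 : 0 < r j.
  rewrite lt_neqAle rge0 andbT; apply: contra Z0 => /eqP r0.
  apply/eqP/matrixP => i c; rewrite !mxE.
  suff -> : r c = 0 by rewrite mul0r.
  by apply/eqP; rewrite eq_le rge0 andbT r0 rj.
have rn0 : r j != 0 by rewrite gt_eqF.
rewrite Phi_polar; last exact: (real_mx_neq0 rn0).
rewrite -(@Phi_proj (r j)^-1 0); last 2 first.
- by apply/eqP => -[/eqP]; rewrite invr_eq0 (negbTE rn0).
- exact: (real_mx_neq0 rn0).
pose r' (l : 'I_m) := (r j)^-1 * r (lift j l).
have -> : Defs.cscale (r j)^-1 0 (real_mx r) = chart j (real_mx r').
  rewrite cscale_real chart_real; congr real_mx; apply/funext => c.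
  by rewrite /chart_ext; case: unliftP => [c' ->|->]//; rewrite mulVf.
have r'01 c : 0 <= r' c <= 1.
  by rewrite /r' mulr_ge0 ?invr_ge0//= mulrC ler_pdivrMr// mul1r rj.
have := unit_cube_le (local_potential_differentiable Phi_smooth a j)
  (local_potential_derive_differentiable Phi_smooth a j)
  (local_potential_torus j)
  (fun w v => local_potential_psh j w v Phi_adm) r'01.
rewrite /local_potential /fs_potential !sqnorm_real chart_real1.
rewrite expr1n sumr_const card_ord.
have -> : 1 + 1 *+ m = a :> R by rewrite -mulrS.
rewrite [leRHS]addrC; apply: le_trans; rewrite lerDr mulr_ge0 ?ler0n// ln_ge0//.
by rewrite lerDl sumr_ge0// => c _; exact: sqr_ge0.
Qed.

End PotentialBounds.

(** * The gradient at the symmetric point *)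

(** The generators permute [nat] and act through [inord], which is faithful only below [N]; hence
    stability of that range is part of the condition. *)
Definition involution_below (N : nat) (s : nat -> nat) :=
  forall p, (p < N)%N -> (s p < N)%N /\ s (s p) = p.

(** [permZ s] is linear, fixes [(1,..,1)] and, [s] being an involution, sends the basis vector of
    index [c] to that of index [s c]. Invariance off the origin holds in a neighbourhood of
    [(1,..,1)], which is enough for derivatives. *)
Lemma permZ_grad_one (R : realType) m (Phi : 'M[R]_(2, m.+1) -> R) (s : nat -> nat)
    (c : 'I_m.+1) :
  involution_below m.+1 s ->
  (forall Z, Z != 0 -> Phi (permZ s Z) = Phi Z) ->
  'D_(delta_mx re_ix c) Phi (real_mx (fun=> 1)) =
  'D_(delta_mx re_ix (inord (s c))) Phi (real_mx (fun=> 1)).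
Proof.
move=> sN Phi_s; set v := delta_mx re_ix c.
have -> : 'D_v Phi (real_mx (fun=> 1)) = 'D_v (Phi \o permZ s) (real_mx (fun=> 1)).
  apply: near_eq_derive.
  have := near_neq0 (one_neq0 R m); apply: filterS => Z Z0 /=.
  by rewrite Phi_s.
have [|_ ->] := @derivable_affine R _ _ Phi (permZ s) (real_mx (fun=> 1)) v (permZ s v).
  by move=> h; apply/matrixP => i j; rewrite !mxE.
have -> : permZ s (real_mx (fun=> 1)) = real_mx (fun=> 1) :> 'M[R]_(2, m.+1).
  by apply/matrixP => i j; rewrite !mxE.
suff -> : permZ s v = delta_mx re_ix (inord (s c)) by [].
apply/matrixP => i j; rewrite !mxE; congr ((_ && _)%:R).
have [sj ssj] := sN _ (ltn_ord j); have [sc ssc] := sN _ (ltn_ord c).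
apply/eqP/eqP => [<-|->]; apply/val_inj; rewrite /= !inordK//; first by rewrite ssj.
by rewrite ssc.
Qed.

Lemma block_swap_involution k n i j : (0 < n)%N -> (i < k)%N -> (j < k)%N ->
  involution_below (k * n) (block_swap n i j).
Proof.
move=> n0 ik jk p pkn.
have lt h : (h < k)%N -> (h * n + p %% n < k * n)%N.
  move=> hk; apply: (@leq_trans (h.+1 * n)); last by rewrite leq_mul2r hk orbT.
  by rewrite mulSn addnC ltn_add2r ltn_mod.
have dv h : ((h * n + p %% n) %/ n = h)%N by rewrite divnMDl// divn_small ?addn0// ltn_mod.
have md h : ((h * n + p %% n) %% n = p %% n)%N by rewrite modnMDl modn_mod.
rewrite {1 3}/block_swap; case: eqP => [pi|pi].
  split; first exact: lt.
  rewrite /block_swap dv md; case: eqP => [ji|_]; last by rewrite eqxx -pi -divn_eq.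
  by rewrite ji -pi -divn_eq.
case: eqP => [pj|pj].
  split; first exact: lt.
  by rewrite /block_swap dv md eqxx -pj -divn_eq.
split => //; rewrite /block_swap; do 2 case: eqP => //.
Qed.

Lemma transp_involution N p q : (p < N)%N -> (q < N)%N ->
  involution_below N (transp p q).
Proof.
move=> pN qN c cN; rewrite {1 3}/transp; case: eqP => [->|cp].
  by split => //; rewrite /transp; case: eqP => [->|]//; rewrite eqxx.
case: eqP => [->|cq]; first by rewrite /transp eqxx.
by split => //; rewrite /transp; do 2 case: eqP => //.
Qed.

(** Transitivity on coordinates in two moves: a block swap carries [c] to an index [p] in the block
    of [c'], then a transposition inside that block carries [p] to [c']. *)
Lemma Gnk_grad_one (R : realType) k n m (Phi : 'M[R]_(2, m.+1) -> R)
    (c c' : 'I_m.+1) :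
  (0 < n)%N -> m.+1 = (k * n)%N -> Gnk_invariant k n Phi ->
  'D_(delta_mx re_ix c) Phi (real_mx (fun=> 1)) =
  'D_(delta_mx re_ix c') Phi (real_mx (fun=> 1)).
Proof.
move=> n0 mkn inv.
have lk (d : 'I_m.+1) : (d %/ n < k)%N by rewrite ltn_divLR// -mkn.
pose p := block_swap n (c %/ n) (c' %/ n) c.
have pE : p = (c' %/ n * n + c %% n)%N by rewrite /p /block_swap eqxx.
have sw : involution_below m.+1 (block_swap n (c %/ n) (c' %/ n)).
  by have := block_swap_involution n0 (lk c) (lk c'); rewrite -mkn.
have [pm _] := sw _ (ltn_ord c).
have pn : (p %/ n = c' %/ n)%N by rewrite pE divnMDl// (divn_small (ltn_pmod _ n0)) addn0.
rewrite (permZ_grad_one c sw); last by move=> Z; apply: inv; exact: Gnk_swap.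
rewrite -/p (permZ_grad_one (inord p) (transp_involution pm (ltn_ord c'))); last first.
  by move=> Z; apply: inv; exact: Gnk_transp.
congr ('D_(delta_mx re_ix _) Phi _); apply/val_inj.
by rewrite /transp inordK// eqxx /= inordK.
Qed.

(** * The dominating function *)

(* No measurability is needed: the integral of a nonnegative function is a supremum
   over the simple functions below it. *)
Lemma le_ge0_integral (d : measure_display) (T : measurableType d) (R : realType)
    (mu : {measure set T -> \bar R}) (f g : T -> \bar R) :
  (forall x, 0 <= f x)%E -> (forall x, f x <= g x)%E ->
  (\int[mu]_x f x <= \int[mu]_x g x)%E.
Proof.
move=> f0 fg; have g0 x : (0 <= g x)%E by exact: le_trans (fg x).
rewrite !ge0_integralTE//; apply: ereal_sup_le; apply: image_subset => h hf x.
exact: le_trans (fg x).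
Qed.

(** Each outer integration fixes the last variable and absorbs its factor [Q t] into the constant.
    So [K] varies in the induction and is extended real, since [Q t] may be [+oo]. Nonnegativity is
    carried along because monotonicity of the next integral uses it. *)
Lemma iter_int_le (R : realType) (Q : R -> \bar R) (J : \bar R) :
  (forall t, 0 <= Q t)%E -> measurable_fun [set: R] Q ->
  (\int[@lebesgue_measure R]_t Q t = J)%E ->
  forall d (F : (nat -> R) -> \bar R) (K : \bar R), (0 <= K)%E ->
  (forall x, 0 <= F x)%E ->
  (forall x, F x <= K * \prod_(i < d) Q (x i))%E ->
  (0 <= iter_int d F <= K * \prod_(i < d) J)%E.
Proof.
move=> Q0 mQ QJ.
have J0 : (0 <= J)%E by rewrite -QJ; exact: integral_ge0.
have P0 d : (0 <= \prod_(i < d) J)%E by apply: prode_ge0.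
elim=> [|d IH] F K K0 F0 FK.
  by rewrite /= F0; have := FK (fun=> 0); rewrite !big_ord0.
have H t : (0 <= iter_int d (fun x => F (fun i => if i == d then t else x i))
    <= (K * Q t) * \prod_(i < d) J)%E.
  apply: IH => [|x|x]; [exact: mule_ge0|exact: F0|].
  apply: le_trans (FK _) _; rewrite big_ord_recr /= eqxx.
  rewrite muleCA muleC le_eqVlt; apply/orP; left; apply/eqP.
  by congr (_ * _)%E; apply: eq_bigr => i _; rewrite (ltn_eqF (ltn_ord i)).
rewrite /=; apply/andP; split.
  by apply: integral_ge0 => t _; have /andP[] := H t.
apply: (@le_trans _ _ (\int[@lebesgue_measure R]_t (K * (\prod_(i < d) J) * Q t))%E).
  apply: le_ge0_integral => t; have /andP[//] := H t.
  by move=> _; rewrite muleAC.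
rewrite ge0_integralZl//; last by rewrite mule_ge0.
by rewrite QJ big_ord_recr/= muleA.
Qed.

Lemma lebesgue_sym_itv (R : realType) (b : R) : 0 <= b ->
  lebesgue_measure (`[- b, b]%classic : set R) = (2 * b)%:E.
Proof.
move=> b0; rewrite lebesgue_measure_itv/= lte_fin.
case: ltP => [_|]; first by rewrite -EFinD; congr EFin; ring.
by move=> bb; congr EFin; lra.
Qed.

Section StepSeries.
Variables (R : realType) (a b : nat -> R).
Hypothesis a_ge0 : forall k, 0 <= a k.
Hypothesis b_ge0 : forall k, 0 <= b k.

(** Measurability and the integral of such a series come term by term, while a pointwise lower bound
    needs a single term. *)
Definition step_series (t : R) : \bar R :=
  (\sum_(0 <= k <oo) (a k * \1_(`[- b k, b k]%classic) t)%:E)%E.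

Lemma step_term_ge0 k t : (0 <= (a k * \1_(`[- b k, b k]%classic) t)%:E)%E.
Proof. by rewrite lee_fin mulr_ge0. Qed.

Lemma step_term_measurable k :
  measurable_fun [set: R] (fun t => (a k * \1_(`[- b k, b k]%classic) t)%:E).
Proof.
apply/measurable_EFinP; apply: measurable_funM; first exact: measurable_cst.
exact: measurable_indic.
Qed.

Lemma step_series_ge0 t : (0 <= step_series t)%E.
Proof. by apply: nneseries_ge0 => k _ _; exact: step_term_ge0. Qed.

Lemma step_series_measurable : measurable_fun [set: R] step_series.
Proof.
have := @ge0_emeasurable_sum _ _ R [set: R] (fun k t =>
  (a k * \1_(`[- b k, b k]%classic) t)%:E) xpredT.
rewrite /step_series; apply => [k t _ _|k _]; first exact: step_term_ge0.
exact: step_term_measurable.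
Qed.

Lemma step_series_ge k t : `|t| <= b k -> ((a k)%:E <= step_series t)%E.
Proof.
move=> tb; have := nneseries_lim_ge k.+1 (fun i (_ : (0 <= i)%N) (_ : xpredT i) => step_term_ge0 i t).
apply: le_trans; rewrite big_nat_recr//=.
have -> : \1_(`[- b k, b k]%classic) t = 1 :> R.
  by rewrite indicE mem_set//= in_itv/= -ler_norml.
rewrite mulr1 leeDr// sume_ge0// => i _; exact: step_term_ge0.
Qed.

Lemma step_series_integral : (\int[@lebesgue_measure R]_t step_series t =
  \sum_(0 <= k <oo) (2 * (a k * b k))%:E)%E.
Proof.
rewrite integral_nneseries//; last 2 first.
- exact: step_term_measurable.
- by move=> k t _; exact: step_term_ge0.
apply: eq_eseriesr => k _.
have mI : measurable_fun [set: R] (fun t => (\1_(`[- b k, b k]%classic) t : R)%:E).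
  by apply/measurable_EFinP; exact: measurable_indic.
transitivity ((a k)%:E * \int[@lebesgue_measure R]_t (\1_(`[- b k, b k]%classic) t : R)%:E)%E.
  apply: (@ge0_integralZl _ _ R (@lebesgue_measure R) _ measurableT _ mI (a k)%:E).
    by move=> t _; rewrite lee_fin.
  by rewrite lee_fin.
transitivity ((a k)%:E * (2 * b k)%:E)%E; last by rewrite -EFinM; congr EFin; ring.
by congr (_ * _)%E; rewrite integral_indic// setIT; exact: lebesgue_sym_itv.
Qed.

End StepSeries.

Lemma geometric_nneseries_lty (R : realType) (A z : R) : 0 <= A -> 0 < z -> z < 1 ->
  (\sum_(0 <= k <oo) (A * z ^+ k)%:E < +oo)%E.
Proof.
move=> A0 z0 z1; apply: (@le_lt_trans _ _ (A / (1 - z))%:E); last exact: ltry.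
apply: lime_le.
  by apply: is_cvg_nneseries => k _ _; rewrite lee_fin mulr_ge0// exprn_ge0// ltW.
apply: nearW => n; rewrite sumEFin lee_fin.
by have := geometric_le_lim n A0 z0; apply; rewrite ger0_norm// ltW.
Qed.

Lemma dyadic_bracket (R : realType) (y : R) : 1 <= y ->
  exists k, 2 ^+ k <= y <= 2 ^+ k.+1.
Proof.
move=> y1.
have ex : exists n, y < 2 ^+ n.
  exists (Num.bound y); apply: (lt_le_trans (archi_boundP _)); first exact: le_trans y1.
  by rewrite -natrX ler_nat ltnW// ltn_expl.
case: (ex_minnP ex) => -[|k]; first by rewrite expr0 ltNge y1.
move=> yk mink; exists k; rewrite (ltW yk) andbT leNgt; apply/negP => /mink.
by rewrite ltnn.
Qed.

Lemma lee_prod (R : realType) (I : Type) (s : seq I) (f g : I -> \bar R) :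
  (forall i, 0 <= f i <= g i)%E -> (\prod_(i <- s) f i <= \prod_(i <- s) g i)%E.
Proof.
move=> fg; suff /andP[] : (0 <= \prod_(i <- s) f i <= \prod_(i <- s) g i)%E by [].
apply: (big_ind2 (fun x y => 0 <= x <= y)%E) => // [|x1 y1 x2 y2 /andP[x10 xy1] /andP[x20 xy2]].
  by rewrite lee01 lexx.
by rewrite mule_ge0//= lee_pmul.
Qed.

(** The logarithm of [|t|^{-al} (1 + t^2)^{-ga}], which is integrable at [0] when [al < 1] and at
    infinity when [al + 2 ga > 1]. *)
Definition sing_weight (R : realType) (al ga t : R) : R :=
  - (al * ln `|t|) - ga * ln (1 + t ^+ 2).

Section Dominating.
Variables (R : realType) (al ga : R).
Hypotheses (al0 : 0 <= al) (al1 : al < 1) (ga0 : 0 <= ga) (alga : 1 < al + 2 * ga).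

(** [rho = 2^al] and [sig = 2^{-(al + 2 ga)}]. The weight is at most [rho^{k+1}] for
    [2^{-(k+1)} <= |t| <= 2^{-k}], and at most [sig^k] for [2^k <= |t| <= 2^{k+1}]. *)
Let rho := expR (al * ln 2) : R.
Let sig := expR (- ((al + 2 * ga) * ln 2)) : R.
Let a1 k : R := rho ^+ k.+1.
Let b1 k : R := 2^-1 ^+ k.
Let a2 k : R := sig ^+ k.
Let b2 k : R := 2 ^+ k.+1.

(* Dyadic majorant of [expR (sing_weight al ga t)]: the first series covers [|t| <= 1],
   the second one [|t| >= 1]. Its value [+oo] at [0] covers the points where a coordinate
   vanishes and [ln 0 = 0] makes [sing_weight] meaningless. *)
Definition dominating (t : R) : \bar R := (step_series a1 b1 t + step_series a2 b2 t)%E.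

Let ln2 : 0 < ln 2 :> R.
Proof. by rewrite ln_gt0// ltr1n. Qed.

Let a1_ge0 k : 0 <= a1 k. Proof. by rewrite exprn_ge0// expR_ge0. Qed.
Let b1_ge0 k : 0 <= b1 k. Proof. by rewrite exprn_ge0// invr_ge0. Qed.
Let a2_ge0 k : 0 <= a2 k. Proof. by rewrite exprn_ge0// expR_ge0. Qed.
Let b2_ge0 k : 0 <= b2 k. Proof. by rewrite exprn_ge0. Qed.

Lemma dominating_measurable : measurable_fun [set: R] dominating.
Proof.
by apply: emeasurable_funD; exact: step_series_measurable.
Qed.

Lemma rho_ge1 : 1 <= rho.
Proof. by rewrite -expR0 ler_expR mulr_ge0// ltW. Qed.

Lemma rho_lt2 : rho < 2.
Proof.
rewrite -[ltRHS]lnK ?posrE// ltr_expR -[ltRHS]mul1r ltr_pM2r//.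
Qed.

Lemma sig_lt : 2 * sig < 1.
Proof.
have -> : 2 * sig = expR (ln 2 - (al + 2 * ga) * ln 2) by rewrite expRD lnK ?posrE.
rewrite -[ltRHS]expR0 ltr_expR.
have : 0 < (al + 2 * ga - 1) * ln 2 by rewrite mulr_gt0// subr_gt0.
by rewrite mulrBl mul1r; lra.
Qed.

(** Height times length gives two geometric series, of ratios [rho / 2] and [2 * sig]; they are
    below [1] by [al < 1] and [1 < al + 2 ga] respectively. *)
Lemma dominating_integral : (\int[@lebesgue_measure R]_t dominating t < +oo)%E.
Proof.
rewrite ge0_integralD//; last 4 first.
- by move=> t _; exact: step_series_ge0.
- exact: step_series_measurable.
- by move=> t _; exact: step_series_ge0.
- exact: step_series_measurable.
rewrite !step_series_integral//; apply: lte_add_pinfty.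
- rewrite (eq_eseriesr (g := fun k => (2 * rho * (rho / 2) ^+ k)%:E)); last first.
    by move=> k _; rewrite /a1 /b1 exprMn exprS; congr EFin; ring.
  apply: geometric_nneseries_lty.
  + by rewrite mulr_ge0// expR_ge0.
  + by rewrite divr_gt0// expR_gt0.
  + by rewrite ltr_pdivrMr// mul1r rho_lt2.
- rewrite (eq_eseriesr (g := fun k => (4 * (2 * sig) ^+ k)%:E)); last first.
    by move=> k _; rewrite /a2 /b2 exprMn exprS; congr EFin; ring.
  apply: geometric_nneseries_lty => //; last exact: sig_lt.
  by rewrite mulr_gt0// expR_gt0.
Qed.

(** The origin lies in every interval and the heights [a1] are at least [1], so the [n]-th partial
    sum is at least [n]. *)
Lemma dominating0 : dominating 0 = +oo%E.
Proof.
apply/eqyP => A A0; apply: (@le_trans _ _ (step_series a1 b1 0)); last first.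
  by rewrite leeDl// step_series_ge0.
have H (n : nat) : (n%:R%:E <= step_series a1 b1 0)%E.
  have := @nneseries_lim_ge R _ xpredT 0 n
    (fun i (_ : (0 <= i)%N) (_ : xpredT i) => step_term_ge0 b1 a1_ge0 i 0).
  apply: le_trans; rewrite sumEFin lee_fin.
  have -> : n%:R = \sum_(0 <= i < n) 1 :> R.
    by rewrite big_mkord sumr_const card_ord.
  apply: ler_sum => k _; rewrite indicE mem_set/=; last first.
    by rewrite in_itv/= oppr_le0 b1_ge0.
  by rewrite mulr1 exprn_ege1// rho_ge1.
apply: le_trans (H (Num.bound A)); by rewrite lee_fin ltW// archi_boundP// ltW.
Qed.

Lemma dominating_ge t : t != 0 -> ((expR (sing_weight al ga t))%:E <= dominating t)%E.
Proof.
move=> t0; have nt0 : 0 < `|t| by rewrite normr_gt0.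
have ln1t : 0 <= ln (1 + t ^+ 2) by rewrite ln_ge0// lerDl sqr_ge0.
rewrite /dominating /sing_weight.
have [t1|t1] := leP 1 `|t|.
  have [k /andP[k1 k2]] := dyadic_bracket t1.
  apply: (@le_trans _ _ (step_series a2 b2 t)); last by rewrite leeDr// step_series_ge0.
  have tb : `|t| <= b2 k by [].
  apply: le_trans (step_series_ge a2_ge0 tb); rewrite lee_fin /a2 -expRM_natl ler_expR.
  (* This merges the two factors of the weight into the single power [|t|^{-(al + 2 ga)}]. *)
  have lt2 : 2 * ln `|t| <= ln (1 + t ^+ 2).
    rewrite mulr_natl -lnXn// ler_ln ?posrE ?exprn_gt0// ?real_normK ?num_real// ?lerDr//.
    by rewrite ltr_pwDl// sqr_ge0.
  have ltk : k%:R * ln 2 <= ln `|t|.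
    by rewrite mulr_natl -lnXn// ler_ln ?posrE ?exprn_gt0.
  have h1 : ga * (2 * ln `|t|) <= ga * ln (1 + t ^+ 2) by rewrite ler_wpM2l.
  have h2 : (al + 2 * ga) * (k%:R * ln 2) <= (al + 2 * ga) * ln `|t|.
    by rewrite ler_wpM2l// ltW// (lt_trans _ alga).
  have -> : k%:R * - ((al + 2 * ga) * ln 2) = - ((al + 2 * ga) * (k%:R * ln 2)) by ring.
  lra.
have t1' : 1 <= `|t|^-1 by rewrite invf_ge1// ltW.
have [k /andP[k1 k2]] := dyadic_bracket t1'.
apply: (@le_trans _ _ (step_series a1 b1 t)); last by rewrite leeDl// step_series_ge0.
have tb : `|t| <= b1 k.
  by rewrite /b1 exprVn -[leLHS]invrK lef_pV2// posrE ?exprn_gt0// invr_gt0.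
apply: le_trans (step_series_ge a1_ge0 tb); rewrite lee_fin /a1 -expRM_natl ler_expR.
have ltk : - ln `|t| <= k.+1%:R * ln 2.
  by rewrite -lnV ?posrE// mulr_natl -lnXn// ler_ln ?posrE ?exprn_gt0// invr_gt0.
have h1 : al * - ln `|t| <= al * (k.+1%:R * ln 2) by rewrite ler_wpM2l.
have h2 : 0 <= ga * ln (1 + t ^+ 2) by rewrite mulr_ge0.
have -> : k.+1%:R * (al * ln 2) = al * (k.+1%:R * ln 2) by ring.
lra.
Qed.

Lemma dominating_gt0 t : (0 < dominating t)%E.
Proof.
have [->|/dominating_ge] := eqVneq t 0; first by rewrite dominating0.
by apply: lt_le_trans; rewrite lte_fin expR_gt0.
Qed.

(** If some coordinate vanishes, its factor is [+oo] and the others are positive, so the bound is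
    trivial. This is why [he] may assume all coordinates nonzero. *)
Lemma le_prod_dominating d (x : nat -> R) (e K : R) : 0 < K ->
  ((forall i : 'I_d, x i != 0) -> e <= K * expR (\sum_(i < d) sing_weight al ga (x i))) ->
  (e%:E <= K%:E * \prod_(i < d) dominating (x i))%E.
Proof.
move=> K0 he.
have P0 (P : pred 'I_d) : (0 < \prod_(i < d | P i) dominating (x i))%E.
  apply: (big_ind (fun y : \bar R => 0 < y)%E) => [|y z|i _]; first exact: lte01.
  - exact: mule_gt0.
  - exact: dominating_gt0.
have [x0|/existsNP[i /negP]] := pselect (forall i : 'I_d, x i != 0).
  apply: le_trans (_ : (K * expR (\sum_(i < d) sing_weight al ga (x i)))%:E <= _)%E.
    by rewrite lee_fin he.
  rewrite EFinM expR_sum -prodEFin; apply: lee_wpmul2l; first by rewrite lee_fin ltW.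
  apply: lee_prod => i; rewrite lee_fin expR_ge0/=; exact: dominating_ge.
rewrite negbK => /eqP xi; rewrite (bigD1 i)//= xi dominating0 gt0_mulye ?P0//.
by rewrite gt0_muley ?lte_fin// leey.
Qed.

End Dominating.

(** * The integral estimate *)

(** The grouping follows [mx_of_coords]: real part at index [2 l], imaginary part at [2 l + 1]. *)
Lemma sum_pairs (R : realType) m (f : nat -> R) :
  \sum_(i < 2 * m) f i = \sum_(l < m) (f (2 * l + 0)%N + f (2 * l + 1)%N).
Proof.
elim: m => [|m IH]; first by rewrite muln0 !big_ord0.
rewrite [RHS]big_ord_recr/= -IH -!(big_mkord xpredT f) mulnS !big_nat_recr//=.
by rewrite addn0 addn1 addrA.
Qed.

(** Separation of variables: [ln (1 + |w|^2)] dominates [ln (1 + t^2)] for each of the [2 m] real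
    coordinates [t], so [B] is shared among them with weight [ga] each. The singular term splits by
    [|x| |y| <= x^2 + y^2]. *)
Lemma weight_exponent_le (R : realType) m (al ga B : R) (w : 'M[R]_(2, m)) :
  0 <= al -> 0 <= ga -> ga * (2 * m%:R) <= B -> (forall r c, w r c != 0) ->
  - (B * ln (1 + sqnorm w)) - al * \sum_l ln (w re_ix l ^+ 2 + w im_ix l ^+ 2) <=
  \sum_l (sing_weight al ga (w re_ix l) + sing_weight al ga (w im_ix l)).
Proof.
move=> al0 ga0 gaB w0; set L := ln (1 + sqnorm w).
have S0 := sqnorm1_gt0 w.
have wS r c : ln (1 + w r c ^+ 2) <= L.
  rewrite ler_ln ?posrE//; last by rewrite ltr_pwDl// sqr_ge0.
  rewrite lerD2l /sqnorm (bigD1 r)//= (bigD1 c)//= -addrA lerDl addr_ge0//.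
    by apply: sumr_ge0 => i _; exact: sqr_ge0.
  by apply: sumr_ge0 => i _; apply: sumr_ge0 => j _; exact: sqr_ge0.
have L0 : 0 <= L by rewrite ln_ge0// lerDl sqnorm_ge0.
have lnxy l : ln `|w re_ix l| + ln `|w im_ix l| <= ln (w re_ix l ^+ 2 + w im_ix l ^+ 2).
  have x0 : 0 < `|w re_ix l| by rewrite normr_gt0.
  have y0 : 0 < `|w im_ix l| by rewrite normr_gt0.
  rewrite -lnM ?posrE// -[w re_ix l ^+ 2]real_normK ?num_real//.
  rewrite -[w im_ix l ^+ 2]real_normK ?num_real//.
  set x := `|w re_ix l| in x0 *; set y := `|w im_ix l| in y0 *.
  have xy : 0 < x * y by rewrite mulr_gt0.
  rewrite ler_ln ?posrE// ?addr_gt0 ?exprn_gt0//.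
  by have := sqr_ge0 (x - y); rewrite sqrrB; lra.
apply: (@le_trans _ _ (\sum_(l < m) (- (ga * (2 * L)) -
    al * ln (w re_ix l ^+ 2 + w im_ix l ^+ 2)))).
  rewrite big_split/= sumr_const card_ord sumrN -mulr_sumr lerD2r.
  rewrite mulNrn lerN2 -(mulr_natr _ m).
  have -> : ga * (2 * L) * m%:R = ga * (2 * m%:R) * L by ring.
  by rewrite ler_wpM2r.
apply: ler_sum => l _; rewrite /sing_weight.
have h1 : ga * ln (1 + w re_ix l ^+ 2) <= ga * L by rewrite ler_wpM2l.
have h2 : ga * ln (1 + w im_ix l ^+ 2) <= ga * L by rewrite ler_wpM2l.
have h3 : al * (ln `|w re_ix l| + ln `|w im_ix l|) <=
  al * ln (w re_ix l ^+ 2 + w im_ix l ^+ 2) by rewrite ler_wpM2l.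
rewrite mulrDr in h3; lra.
Qed.

Section Integrand.
Variables (R : realType) (m : nat) (Phi : 'M[R]_(2, m.+1) -> R).
Let a : R := m.+1%:R.
Hypothesis Phi_proj : proj_invariant Phi.
Hypothesis Phi_smooth : smooth_on [set Z | Z != 0] Phi.
Hypothesis Phi_adm : admissible a Phi.
Hypothesis Phi_rot : forall (p : 'I_m.+1) th Z, Z != 0 -> Phi (rotZ p th Z) = Phi Z.
Hypothesis Phi_sym : forall c c' : 'I_m.+1,
  'D_(delta_mx re_ix c) Phi (real_mx (fun=> 1)) =
  'D_(delta_mx re_ix c') Phi (real_mx (fun=> 1)).
Hypothesis Phi_sup : sup [set Phi Z | Z in [set Z | Z != 0]] = 0.

(* [sup] of a set that is not bounded above is [0] by convention, so the upper bound
   is also what gives the hypothesis on the supremum its meaning. *)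
Lemma Phi_le0 Z : Z != 0 -> Phi Z <= 0.
Proof.
move=> Z0; rewrite -Phi_sup; apply: sup_upper_bound; last by exists Z.
split; first by exists (Phi Z), Z.
exists (Phi (real_mx (fun=> 1)) + a * ln a) => _ [Y Y0 <-].
exact: Phi_upper.
Qed.

Lemma Phi_one_ge : 0 <= a * ln a + Phi (real_mx (fun=> 1)).
Proof.
rewrite addrC -Phi_sup; apply: ge_sup.
  by exists (Phi (real_mx (fun=> 1))), (real_mx (fun=> 1)) => //; exact: one_neq0.
by move=> _ [Y Y0 <-]; exact: Phi_upper.
Qed.

(** [Phi_lower] at the moduli of [w], which are positive here; [Phi_one_ge] removes the constant. *)
Lemma Phi_chart_ge (w : 'M[R]_(2, m)) : (forall r c, w r c != 0) ->
  \sum_l ln (w re_ix l ^+ 2 + w im_ix l ^+ 2) - a * ln (1 + sqnorm w) <=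
  Phi (chart ord0 w).
Proof.
move=> w0; have [r [th [rE wE]]] := polar_decomposition w.
have q0 l : 0 < w re_ix l ^+ 2 + w im_ix l ^+ 2.
  by rewrite ltr_pwDl ?sqr_ge0// exprn_even_gt0//=.
have r0 l : 0 < r l by rewrite rE sqrtr_gt0.
have := Phi_lower Phi_proj Phi_smooth Phi_adm Phi_rot Phi_sym r0.
have -> : Phi (chart ord0 (real_mx r)) = Phi (chart ord0 w).
  by rewrite wE chart_polar chart_real Phi_polar// chart_ext_neq0.
have -> : \sum_l r l ^+ 2 = sqnorm w by rewrite wE sqnorm_polar.
have -> : 2 * \sum_l ln (r l) = \sum_l ln (w re_ix l ^+ 2 + w im_ix l ^+ 2).
  rewrite mulr_sumr; apply: eq_bigr => l _.
  by rewrite mulr_natl -lnXn// rE sqr_sqrtr// ltW.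
by have := Phi_one_ge; rewrite -/a; lra.
Qed.

(** Since [Phi <= 0], the exponent [alpha] may be raised to [al >= 0], and then [Phi_chart_ge]
    applies. The volume density supplies [- a ln (1 + |w|^2)], of which the share [1 - al] remains
    to be distributed over the coordinates. *)
Lemma integrand_le (alpha al ga : R) (w : 'M[R]_(2, m)) :
  alpha <= al -> 0 <= al -> 0 <= ga -> ga * (2 * m%:R) <= (1 - al) * a ->
  (forall r c, w r c != 0) ->
  expR (- (alpha * Phi (chart ord0 w))) * vol_density a w <=
  a ^+ m * expR (\sum_l (sing_weight al ga (w re_ix l) + sing_weight al ga (w im_ix l))).
Proof.
move=> aal al0 ga0 gaB w0; rewrite vol_densityE mulrCA.
have S0 := sqnorm1_gt0 w.
rewrite ler_wpM2l ?exprn_ge0// ?ler0n//.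
have -> : (1 + sqnorm w) ^- m.+1 = expR (- (a * ln (1 + sqnorm w))).
  by rewrite expRN expRM_natl lnK ?posrE.
rewrite -expRD ler_expR.
apply: le_trans (weight_exponent_le al0 ga0 gaB w0).
have P0 := Phi_le0 (chart_neq0 ord0 w).
have h1 : al * Phi (chart ord0 w) <= alpha * Phi (chart ord0 w).
  by rewrite ler_wnM2r.
have h2 : al * (\sum_l ln (w re_ix l ^+ 2 + w im_ix l ^+ 2) - a * ln (1 + sqnorm w)) <=
  al * Phi (chart ord0 w) by rewrite ler_wpM2l// Phi_chart_ge.
rewrite mulrBr in h2; rewrite mulrBl mul1r mulrBl -[al * a * _]mulrA.
lra.
Qed.

(** The right-hand side does not involve [Phi], which is the uniformity required of the constant. *)
Lemma integral_exp_le (alpha al ga : R) :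
  alpha <= al -> 0 <= al -> al < 1 -> 0 <= ga -> 1 < al + 2 * ga ->
  ga * (2 * m%:R) <= (1 - al) * a ->
  (integral_exp a alpha Phi <= (a ^+ m)%:E * \prod_(i < 2 * m)
     \int[@lebesgue_measure R]_t dominating al ga t)%E.
Proof.
move=> aal al0 al1 ga0 alga gaB.
have a0 : 0 < a by rewrite ltr0n.
have e0 (w : 'M[R]_(2, m)) :
    0 <= expR (- (alpha * Phi (chart ord0 w))) * vol_density a w.
  rewrite vol_densityE mulr_ge0 ?expR_ge0// divr_ge0// exprn_ge0// ?ltW//.
  exact: sqnorm1_gt0.
have := @iter_int_le R (dominating al ga) _
  (fun t => ltW (dominating_gt0 al0 ga0 alga t)) (dominating_measurable al ga) erefl
  (2 * m)%N (fun x => (expR (- (alpha * Phi (chart ord0 (mx_of_coords x))))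
                       * vol_density a (mx_of_coords x))%:E) (a ^+ m)%:E.
move=> H; suff /andP[] : (0 <= integral_exp a alpha Phi <= (a ^+ m)%:E * \prod_(i < 2 * m)
     \int[@lebesgue_measure R]_t dominating al ga t)%E by [].
apply: H => [|x|x]; first by rewrite lee_fin exprn_ge0// ltW.
  by rewrite lee_fin.
apply: le_prod_dominating => //; first exact: exprn_gt0.
move=> x0; rewrite (sum_pairs m (fun i => sing_weight al ga (x i))).
have := @integrand_le alpha al ga (mx_of_coords x) aal al0 ga0 gaB.
under eq_bigr do rewrite !mxE/=.
apply => r c; rewrite mxE.
have lt2 : (2 * c + r < 2 * m)%N.
  have := ltn_ord c; have := ltn_ord r; lia.
exact: (x0 (Ordinal lt2)).
Qed.

End Integrand.

(* m = k n - 1, so points of C^{m+1} = C^{kn} are 'M_(2, (k*n).-1.+1);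
   a_m = m + 1. *)
Theorem theorem2 (R : realType) (k n : nat) :
  (1 <= k)%N -> (1 <= n)%N ->
  forall alpha : R, alpha < 1 ->
  exists C : R,
    forall Phi : 'M[R]_(2, (k * n).-1.+1) -> R,
      proj_invariant Phi ->
      smooth_on [set Z | Z != 0] Phi ->
      admissible ((k * n).-1.+1)%:R Phi ->
      Gnk_invariant k n Phi ->
      sup [set Phi Z | Z in [set Z | Z != 0]] = 0 ->
      (integral_exp ((k * n).-1.+1)%:R alpha Phi <= C%:E)%E.
Proof.
move=> k1 n1 alpha alpha1.
have mkn : (k * n).-1.+1 = (k * n)%N by rewrite prednK// muln_gt0 k1 n1.
(* The predecessor becomes a variable [m], so that the lemmas stated for [m.+1] apply directly. *)
move: ((k * n).-1) mkn => m mkn.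
pose al := Num.max alpha 0; pose N : R := m.+1%:R.
(* Any [ga] with [1 - al < 2 ga] and [2 m ga <= (1 - al) N] would do. *)
pose ga := (1 - al) * N / (2 * N - 1).
have al0 : 0 <= al by rewrite le_max lexx orbT.
have al1 : al < 1 by rewrite gt_max alpha1 ltr01.
have aal : alpha <= al by rewrite le_max lexx.
have N1 : 1 <= N by rewrite ler1n.
have D0 : 0 < 2 * N - 1 by lra.
have B0 : 0 < 1 - al by lra.
have ga0 : 0 <= ga by rewrite divr_ge0 ?mulr_ge0//; lra.
have alga : 1 < al + 2 * ga.
  have : 1 - al < 2 * ga.
    rewrite /ga mulrA ltr_pdivlMr//.
    have -> : 2 * ((1 - al) * N) = (1 - al) * (2 * N) by ring.
    by rewrite ltr_pM2l//; lra.
  lra.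
have gaB : ga * (2 * m%:R) <= (1 - al) * N.
  rewrite /ga mulrAC ler_pdivrMr//; apply: ler_wpM2l.
    by rewrite mulr_ge0//; lra.
  by rewrite /N -natr1; lra.
set J := (\int[@lebesgue_measure R]_t dominating al ga t)%E.
have J0 : (0 <= J)%E.
  by apply: integral_ge0 => t _; exact: ltW (dominating_gt0 al0 ga0 alga t).
(* Finiteness of [J] turns the extended-real bound into a real constant. *)
have JE : J = (fine J)%:E.
  by rewrite fineK// ge0_fin_numE// dominating_integral.
exists (N ^+ m * \prod_(i < 2 * m) fine J) => Phi hproj hsm hadm hinv hsup.
have hrot (p : 'I_m.+1) th Z : Z != 0 -> Phi (rotZ p th Z) = Phi Z.
  by move=> Z0; apply: hinv => //; apply: Gnk_rot; exact: ltn_ord.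
have hsym c c' := Gnk_grad_one c c' n1 mkn hinv.
have := integral_exp_le hproj hsm hadm hrot hsym hsup aal al0 al1 ga0 alga gaB.
by rewrite -/J JE prodEFin.
Qed.
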